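(* Let $G$ be a 1-path 1-dof tree-decomposable graph with no $K_3$ subgraph. Then $G$ is LCC if and only if $G$ is planar.
   Context: All graphs are finite and simple. A nonedge of a graph $G$ is a pair of distinct vertices not joined by an edge, and $G\cup f$ denotes $G$ with the edge $f$ added. A graph is tree-decomposable if it is a single edge, or it is the union of three tree-decomposable graphs such that each pair shares exactly one vertex and the three shared vertices are distinct. A graph $G$ is 1-dof tree-decomposable if it has a nonedge $f$ such that $G\cup f$ is tree-decomposable; every such $f$ is called a base nonedge of $G$. A cluster of a 1-dof tree-decomposable graph $G$ is a maximal tree-decomposable subgraph of $G$. Construction from a base nonedge $f=(v_0,v_0')$: $G$ is built starting from $G_f(0)$, the graph with the two vertices $v_0,v_0'$ and no edges. At the $k$-th construction step, written $v_k\triangleleft(u_k,w_k)$, two new clusters $T,T'$ of $G$ that share exactly one vertex $v_k$ (the step vertex) are appended to $G_f(k-1)$, where $T\cap G_f(k-1)$ is the single vertex $u_k$, $T'\cap G_f(k-1)$ is the single vertex $w_k$, and $u_k\neq w_k$; the result is $G_f(k)$. The steps may be ordered arbitrarily as long as $u_k,w_k\in G_f(k-1)$ for each $k$. The vertices $u_k,w_k$ are the base vertices of the step, and the vertices of $T\cup T'$ other than $u_k,w_k$ are the vertices added by the step. A construction step is final-level if no vertex added by it is a base vertex of any construction step. A construction of $G$ from $f$ is 1-path if it has exactly one final-level step (one final-level step vertex, with its two clusters). $G$ is 1-path if it is 1-dof tree-decomposable and has a 1-path construction from some base nonedge. The $k$-th extreme graph $\hat G_f(k)$ is $G_f(k-1)$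 with the edge $(u_k,w_k)$ added. $G$ is LCC (has low Cayley complexity) on $f$ if all extreme graphs in the construction of $G$ from $f$ are tree-decomposable; $G$ is LCC if it is LCC on some base nonedge. *)

(* Defs.v *)
From HB Require Import structures.
From mathcomp Require Import all_boot all_order all_algebra.

Set Implicit Arguments.
Unset Strict Implicit.
Unset Printing Implicit Defensive.

(** Finite graphs whose vertices live in a finite type [V].  The vertex set is
    part of the data, since the constructions below take unions and
    intersections of graphs on different vertex sets. *)
Record sgraph (V : finType) := SGraph {
  verts : {set V};
  edges : {set {set V}} }.

Definition simple_graph (V : finType) (G : sgraph V) : Prop :=
  forall e, e \in edges G -> #|e| = 2 /\ e \subset verts G.

Definition subgraph (V : finType) (H G : sgraph V) : Prop :=
  verts H \subset verts G /\ edges H \subset edges G.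

Definition gunion (V : finType) (G H : sgraph V) : sgraph V :=
  SGraph (verts G :|: verts H) (edges G :|: edges H).

Definition edge_graph (V : finType) (x y : V) : sgraph V :=
  SGraph [set x; y] [set [set x; y]].

Definition add_edge (V : finType) (G : sgraph V) (x y : V) : sgraph V :=
  SGraph (verts G) ([set x; y] |: edges G).

Definition nonedge (V : finType) (G : sgraph V) (x y : V) : Prop :=
  [/\ x \in verts G, y \in verts G, x != y & [set x; y] \notin edges G].

Definition has_K3 (V : finType) (G : sgraph V) : Prop :=
  exists x y z : V, uniq [:: x; y; z] /\
    [/\ [set x; y] \in edges G, [set y; z] \in edges G
      & [set x; z] \in edges G].

(** * Tree-decomposability *)

Inductive tree_dec (V : finType) : sgraph V -> Prop :=
| tree_dec_edge (x y : V) : x != y -> tree_dec (edge_graph x y)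
| tree_dec_union (A B C : sgraph V) (a b c : V) :
    tree_dec A -> tree_dec B -> tree_dec C ->
    verts B :&: verts C = [set a] ->
    verts A :&: verts C = [set b] ->
    verts A :&: verts B = [set c] ->
    uniq [:: a; b; c] ->
    tree_dec (gunion (gunion A B) C).

Definition base_nonedge (V : finType) (G : sgraph V) (x y : V) : Prop :=
  nonedge G x y /\ tree_dec (add_edge G x y).

Definition dof1_tree_dec (V : finType) (G : sgraph V) : Prop :=
  exists x y : V, base_nonedge G x y.

Definition is_cluster (V : finType) (G T : sgraph V) : Prop :=
  [/\ subgraph T G, tree_dec T &
      forall T' : sgraph V,
        subgraph T' G -> tree_dec T' -> subgraph T T' -> T' = T].

(** * Constructions from a base nonedge *)

(** The step v <| (u, w), together with the two clusters it appends:
    [left_cl] contains the base vertex u and [right_cl] the base vertex w. *)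
Record cstep (V : finType) := CStep {
  step_vertex : V;
  left_base : V;
  right_base : V;
  left_cl : sgraph V;
  right_cl : sgraph V }.

Definition append_step (V : finType) (H : sgraph V) (st : cstep V) : sgraph V :=
  gunion (gunion H (left_cl st)) (right_cl st).

(** G_f(k) for f = (x, y): the graph obtained after the first [k] steps of [s].
    Steps are numbered from 0 in [s], so step [k] of [s] goes from
    [stage x y s k] to [stage x y s k.+1]. *)
Definition stage (V : finType) (x y : V) (s : seq (cstep V)) (k : nat) :
    sgraph V :=
  foldl (@append_step V) (SGraph [set x; y] set0) (take k s).

Definition valid_step (V : finType) (G H : sgraph V) (st : cstep V) : Prop :=
  [/\ is_cluster G (left_cl st) /\ is_cluster G (right_cl st),
      verts (left_cl st) :&: verts (right_cl st) = [set step_vertex st],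
      verts (left_cl st) :&: verts H = [set left_base st],
      verts (right_cl st) :&: verts H = [set right_base st]
    & left_base st != right_base st].

Definition construction (V : finType) (G : sgraph V) (x y : V)
    (s : seq (cstep V)) : Prop :=
  [/\ base_nonedge G x y,
      forall k st, onth s k = Some st -> valid_step G (stage x y s k) st
    & stage x y s (size s) = G].

Definition added (V : finType) (st : cstep V) : {set V} :=
  (verts (left_cl st) :|: verts (right_cl st))
    :\: [set left_base st; right_base st].

Definition final_level (V : finType) (s : seq (cstep V)) (st : cstep V) : bool :=
  all (fun st' => (left_base st' \notin added st)
               && (right_base st' \notin added st)) s.

Definition one_path_construction (V : finType) (G : sgraph V) (x y : V)
    (s : seq (cstep V)) : Prop :=
  construction G x y s /\ count (final_level s) s = 1.

Definition one_path (V : finType) (G : sgraph V) : Prop :=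
  dof1_tree_dec G /\
  exists (x y : V) (s : seq (cstep V)), one_path_construction G x y s.

(** * Low Cayley complexity *)

(** The extreme graph of step [st], the step of index [k] in [s]. *)
Definition extreme_graph (V : finType) (x y : V) (s : seq (cstep V)) (k : nat)
    (st : cstep V) : sgraph V :=
  add_edge (stage x y s k) (left_base st) (right_base st).

(** Constructions from a given base nonedge differ only by the order of the
    steps and the naming of the two sides of a step, which do not affect
    whether the extreme graphs are tree-decomposable; [s] is thus "the"
    construction of [G] from (x, y). *)
Definition LCC_on (V : finType) (G : sgraph V) (x y : V) : Prop :=
  exists s : seq (cstep V), construction G x y s /\
    forall k st, onth s k = Some st -> tree_dec (extreme_graph x y s k st).

Definition LCC (V : finType) (G : sgraph V) : Prop :=
  exists x y : V, LCC_on G x y.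

(** * Planarity *)

(* Loaded only here, so that the set notations above are those of finset. *)
From mathcomp Require Import all_classical all_reals all_analysis.
Import Order.TTheory GRing.Theory Num.Theory.
Import numFieldNormedType.Exports.
Local Open Scope classical_set_scope.
Local Open Scope ring_scope.

(** A drawing of [G] in the plane: vertices are sent to distinct points, and
    edges to arcs (injective continuous images of [0, 1]) joining their ends,
    such that the interior of an arc contains no vertex and no point of the
    interior of another arc. *)
Definition plane_drawing (R : realType) (V : finType) (G : sgraph V)
    (p : V -> R * R) (g : {set V} -> R -> R * R) : Prop :=
  [/\ {in verts G &, injective p},
      forall e, e \in edges G ->
        [/\ {within `[0, 1]%classic, continuous (g e)},
            {in `[0, 1] &, injective (g e)}
          & exists x y : V, [/\ e = [set x; y]%SET, g e 0 = p x & g e 1 = p y]],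
      forall e v (t : R), e \in edges G -> v \in verts G ->
        t \in `]0, 1[ -> g e t <> p v
    & forall e e' (t t' : R),
        e \in edges G -> e' \in edges G -> e != e' ->
        t \in `]0, 1[ -> t' \in `]0, 1[ -> g e t <> g e' t'].

Definition planar (R : realType) (V : finType) (G : sgraph V) : Prop :=
  exists (p : V -> R * R) (g : {set V} -> R -> R * R), plane_drawing G p g.

(* Main.v *)
(** In a triangle-free graph every tree-decomposable subgraph is a single edge, so a
    construction adds one vertex of degree 2 at a time, on two nonadjacent base vertices.
    From the third step on, such a construction has tree-decomposable extreme graphs if
    and only if the two base vertices of each step have at least two common neighbors at
    that time.

    Planar implies LCC.  Suppose that a step on [p], [q] is the first one whose base
    vertices have fewer than two common neighbors, and reduce to the case where [p] was
    added last, on [u], [w].  Then some vertex [m], joined to [q] outside [u], [w] and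
    their common neighbors, is adjacent to two common neighbors [x], [x'] of [u] and [w],
    and [u], [w], [m] against [x], [x'], [p] is a subdivided K_{3,3}.  That it has no
    drawing by continuous arcs is shown by counting modulo 2 the crossings of arcs with
    vertical rays: two disjoint arcs [P], [Q] give a relation between these parities by
    summing over the cells of a fine grid for the map (s, t) |-> Q t - P s, which avoids
    the origin.

    LCC implies planar.  Having two common neighbors at each step does not depend on the
    construction, because a vertex of degree 2 can be removed from such a graph.  In a
    1-path construction the step vertices not yet used as base vertices are, at each
    stage, the last one alone or the last two, having the same neighbors.  Hence each new
    vertex can be drawn on a segment starting at the previous one, inside an empty
    triangle. *)
Require Import Defs.
From Stdlib Require Import Ring.
From mathcomp Require Import all_boot all_order all_algebra.

Set Implicit Arguments.
Unset Strict Implicit.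
Unset Printing Implicit Defensive.

(** * Henneberg steps *)

Lemma set2_eqE (V : finType) (a b c d : V) :
  ([set a; b] == [set c; d]) =
  (a == c) && (b == d) || (a == d) && (b == c).
Proof.
apply/eqP/idP => [E|/orP[]/andP[/eqP-> /eqP->] //]; last by rewrite setUC.
have H z : (z \in [set a; b]) = (z \in [set c; d]) by rewrite E.
have := H a; have := H b; have := H c; have := H d.
rewrite !inE !eqxx ?orbT /= (eq_sym d a) (eq_sym d b) (eq_sym c a) (eq_sym c b).
by do 4 case: (_ == _).
Qed.

Lemma sgraph_eq (V : finType) (G H : sgraph V) :
  verts G = verts H -> edges G = edges H -> G = H.
Proof. by case: G H => [A E] [B F] /= -> ->. Qed.

Definition adj (V : finType) (G : sgraph V) (a b : V) : bool :=
  [set a; b] \in edges G.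

Definition ext (V : finType) (G : sgraph V) (v u w : V) : sgraph V :=
  SGraph (v |: verts G) ([set v; u] |: ([set v; w] |: edges G)).

Definition pairg (V : finType) (x y : V) : sgraph V := SGraph [set x; y] set0.

Definition triangle_free (V : finType) (G : sgraph V) : Prop :=
  forall a b c, adj G a b -> adj G b c -> adj G a c -> False.

(** Two common neighbors. Provided the earlier steps satisfy it, this is what tree-decomposability
    of the extreme graph amounts to from the third step on. *)
Definition codeg2 (V : finType) (G : sgraph V) (u w : V) : Prop :=
  u != w /\ exists c d, [/\ c != d, adj G u c, adj G w c, adj G u d & adj G w d].

Section Basics.
Variable V : finType.
Implicit Types (G H : sgraph V) (a b c d u v w x y z : V).

Lemma adjC G a b : adj G a b = adj G b a.
Proof. by rewrite /adj setUC. Qed.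

Lemma simple_adj G a b : simple_graph G -> adj G a b ->
  [/\ a != b, a \in verts G & b \in verts G].
Proof.
move=> sG /sG[]; rewrite cards2 => ab /subsetP sub.
by split; [case: (a != b) ab | |]; rewrite ?sub ?inE ?eqxx ?orbT.
Qed.

Lemma simple_pairg x y : simple_graph (pairg x y).
Proof. by move=> e; rewrite inE. Qed.

Lemma extC G v u w : ext G v u w = ext G v w u.
Proof. by rewrite /ext setUCA. Qed.

Lemma ext_comm G v u w z a b :
  ext (ext G v u w) z a b = ext (ext G z a b) v u w.
Proof.
apply: sgraph_eq => /=; first by rewrite setUCA.
apply/setP => e; rewrite !inE.
by do 4 case: (e == _); rewrite /= ?orbT.
Qed.

Lemma adj_ext G v u w a b : adj (ext G v u w) a b =
  [|| adj G a b, (a == v) && ((b == u) || (b == w))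
    | (b == v) && ((a == u) || (a == w))].
Proof.
rewrite /adj !inE !set2_eqE.
by do 6 case: (_ == _); rewrite /= ?orbT ?orbF.
Qed.

Lemma adj_extW G v u w a b : adj G a b -> adj (ext G v u w) a b.
Proof. by rewrite adj_ext => ->. Qed.

Lemma simple_ext G v u w : simple_graph G -> v \notin verts G ->
  u \in verts G -> w \in verts G -> simple_graph (ext G v u w).
Proof.
move=> sG vG uG wG e; rewrite !inE.
have ne z : z \in verts G -> v != z by apply: contraTneq => <-.
case/or3P => [/eqP->|/eqP->|/sG[e2 /subsetP eG]].
- rewrite cards2 ne //; split=> //; apply/subsetP => z.
  by rewrite !inE => /orP[]/eqP->; rewrite ?uG ?eqxx ?orbT.
- rewrite cards2 ne //; split=> //; apply/subsetP => z.
  by rewrite !inE => /orP[]/eqP->; rewrite ?wG ?eqxx ?orbT.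
- by split=> //; apply/subsetP => z /eG zG; rewrite !inE zG orbT.
Qed.

Lemma codeg2C G u w : codeg2 G u w -> codeg2 G w u.
Proof.
by case=> uw [c [d [? ? ? ? ?]]]; split; [rewrite eq_sym | exists c, d].
Qed.

Lemma codeg2W G v a b u w : codeg2 G u w -> codeg2 (ext G v a b) u w.
Proof.
by case=> uw [c [d [? ? ? ? ?]]]; split=> //; exists c, d; split=> //; apply: adj_extW.
Qed.

Lemma adj_ext_old G v a b u w : u != v -> w != v ->
  adj (ext G v a b) u w = adj G u w.
Proof. by move=> /negPf uv /negPf wv; rewrite adj_ext uv wv orbF. Qed.

Lemma adj_ext_new G v a b c : simple_graph G -> v \notin verts G ->
  a \in verts G -> b \in verts G -> adj (ext G v a b) v c = (c == a) || (c == b).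
Proof.
move=> sG vG aG bG; rewrite adj_ext eqxx /=.
have -> : adj G v c = false.
  by apply: contraNF vG => /(simple_adj sG)[].
have /negPf-> : v != a by apply: contraNneq vG => ->.
have /negPf-> : v != b by apply: contraNneq vG => ->.
by rewrite andbF orbF.
Qed.

(* The graphs obtained from the nonedge [x y] by Henneberg steps: in a triangle-free
   graph every cluster is a single edge, so these are the graphs with base nonedge
   [x y], see [hen_tree_dec] and [tree_dec_hen]. *)
Inductive hen (x y : V) : sgraph V -> Prop :=
| hen0 : x != y -> hen x y (pairg x y)
| henS G v u w : hen x y G -> v \notin verts G -> u \in verts G ->
    w \in verts G -> u != w -> ~~ adj G u w -> hen x y (ext G v u w).

Lemma hen_simple x y G : hen x y G -> simple_graph G.
Proof. by elim=> [_|*]; [exact: simple_pairg | exact: simple_ext]. Qed.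

Lemma hen_base x y G : hen x y G ->
  [/\ x != y, x \in verts G, y \in verts G & ~~ adj G x y].
Proof.
elim=> [xy|{}G v u w hG [xy xG yG nxy] vG uG wG uw nuw].
  by split; rewrite // /adj !inE ?eqxx ?orbT.
have xv : x != v by apply: contraNneq vG => <-.
have yv : y != v by apply: contraNneq vG => <-.
by rewrite !inE xG yG !orbT adj_ext_old //; exact: hen_simple hG.
Qed.

Lemma hen_sym x y G : hen x y G -> hen y x G.
Proof.
elim=> [xy|*]; last exact: henS.
by rewrite /pairg setUC; apply: hen0; rewrite eq_sym.
Qed.

Lemma hen_triangle_free x y G : hen x y G -> triangle_free G.
Proof.
elim=> [xy|{}G v u w hG tf vG uG wG uw nuw] a b c; first by rewrite /adj inE.
have sG := hen_simple hG.
have nv d : adj G v d = false by apply: contraNF vG => /(simple_adj sG)[].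
have nv' d : adj G d v = false by rewrite adjC.
have irr d : adj G d d = false by apply/negP => /(simple_adj sG)[]; rewrite eqxx.
have uv : u != v by apply: contraNneq vG => <-.
have wv : w != v by apply: contraNneq vG => <-.
have vu : (v == u) = false by rewrite eq_sym (negPf uv).
have vw : (v == w) = false by rewrite eq_sym (negPf wv).
rewrite !adj_ext.
have [->|av] := eqVneq a v; have [->|bv] := eqVneq b v;
  have [->|cv] := eqVneq c v; rewrite ?nv ?nv' /= ?eqxx ?orbF //;
  rewrite ?vu ?vw //=.
- by move=> /orP[]/eqP-> A /orP[]/eqP E; move: A; rewrite E ?irr // 1?adjC ?(negPf nuw) // adjC (negPf nuw).
- by move=> /orP[]/eqP-> /orP[]/eqP->; rewrite ?irr // 1?adjC ?(negPf nuw) // adjC (negPf nuw).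
- by move=> A /orP[]/eqP E /orP[]/eqP E'; move: A; rewrite E E' ?irr // 1?adjC ?(negPf nuw) // adjC (negPf nuw).
- exact: tf.
Qed.

Lemma codeg2_nadj G u w : triangle_free G -> codeg2 G u w -> ~~ adj G u w.
Proof.
by move=> tf [_ [c [d [_ uc wc _ _]]]]; apply/negP => /tf/(_ wc uc).
Qed.

Lemma simple_codeg2_verts G u w : simple_graph G -> codeg2 G u w ->
  [/\ u != w, u \in verts G & w \in verts G].
Proof.
by move=> sG [? [c [d [_ uc wc _ _]]]]; split=> //; [case: (simple_adj sG uc) | case: (simple_adj sG wc)].
Qed.

(** The 4-cycle as [K_{2,2}] with sides [x], [y] and [a], [b]. *)
Definition C4 x y a b : sgraph V := ext (ext (pairg x y) a x y) b x y.

Inductive quad : sgraph V -> Prop :=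
| quad0 x y a b : uniq [:: x; y; a; b] -> quad (C4 x y a b)
| quadS G v u w : quad G -> v \notin verts G -> codeg2 G u w ->
    quad (ext G v u w).

Lemma hen_P3 x y a : x != y -> a != x -> a != y -> hen x y (ext (pairg x y) a x y).
Proof.
move=> xy ax ay; apply: henS (hen0 xy) _ _ _ xy _;
  by rewrite /adj !inE ?negb_or ?ax ?ay ?eqxx ?orbT.
Qed.

Lemma hen_C4 x y a b : uniq [:: x; y; a; b] -> hen x y (C4 x y a b).
Proof.
rewrite /= !inE !negb_or !andbT => /and3P[/and3P[xy xa xb] /andP[ya yb] ab].
have hP : hen x y (ext (pairg x y) a x y) by apply: hen_P3; rewrite // eq_sym.
apply: henS hP _ _ _ xy _; rewrite ?inE ?eqxx ?orbT //.
  by rewrite !negb_or ![b == _]eq_sym ab xb yb.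
by rewrite adj_ext_old ?/(adj (pairg _ _)) ?inE //; apply: simple_pairg.
Qed.

Lemma C4_swap x y a b : C4 x y a b = C4 a b x y.
Proof.
apply: sgraph_eq => /=.
  by apply/setP => z; rewrite !inE; do 4 case: (z == _).
apply/setP => e; rewrite !inE !orbF.
rewrite (setUC [set b] [set x]) (setUC [set b] [set y]).
rewrite (setUC [set a] [set x]) (setUC [set a] [set y]).
by do 4 case: (e == _).
Qed.

Lemma quad_hen0 G : quad G -> exists x y, hen x y G.
Proof.
elim=> [x y a b U|{}G v u w _ [x [y hG]] vG t].
  by exists x, y; apply: hen_C4.
have [? ? ?] := simple_codeg2_verts (hen_simple hG) t.
exists x, y; apply: henS => //; exact: codeg2_nadj (hen_triangle_free hG) t.
Qed.

Lemma quad_simple G : quad G -> simple_graph G.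
Proof. by case/quad_hen0 => x [y /hen_simple]. Qed.

Lemma quad_triangle_free G : quad G -> triangle_free G.
Proof. by case/quad_hen0 => x [y /hen_triangle_free]. Qed.

End Basics.

(** * Change of base nonedge and deletion of vertices of degree 2 *)

Section Quad.
Variable V : finType.
Implicit Types (G H : sgraph V) (a b c d u v w x y z : V).

(** The pairs [p], [q] and [z], [v] are the diagonals of a 4-cycle, so either can serve as base; the
    steps of [G] commute past [z] and [v] and are replayed on top. *)
Lemma hen_rebase G p q z v : hen p q G -> z \notin verts G -> v \notin verts G ->
  z != v -> hen z v (ext (ext G v p q) z p q).
Proof.
move=> hG; elim: hG z v => [pq|{}G t a b hG IH tG aG bG ab nab] z v.
  rewrite /= !inE !negb_or => /andP[zp zq] /andP[vp vq] zv.
  apply: hen_sym; rewrite -/(C4 p q v z) C4_swap; apply: hen_C4.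
  by rewrite /= !inE !negb_or ![v == z]eq_sym zv vp vq zp zq pq.
rewrite /= !inE !negb_or => /andP[zt zG] /andP[vt vG] zv.
have [pq pG qG _] := hen_base hG; have sG := hen_simple hG.
rewrite (ext_comm _ t) (ext_comm _ t).
have nz c : c \in verts G -> c != z by apply: contraTneq => ->.
have nv c : c \in verts G -> c != v by apply: contraTneq => ->.
apply: henS (IH _ _ zG vG zv) _ _ _ ab _; rewrite ?inE ?aG ?bG ?orbT //.
  by rewrite !negb_or ![t == _]eq_sym zt vt.
by rewrite adj_ext_old ?nz ?adj_ext_old ?nv //; apply: simple_ext.
Qed.

(** Undo the construction down to the step that adds [w]: there [w] is joined to exactly [p] and
    [q], so [hen_rebase] applies. Later steps commute with the one adding [z]. *)
Lemma hen_twin G p q z w : hen p q G -> adj G w p -> adj G w q ->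
  z \notin verts G -> hen z w (ext G z p q).
Proof.
move=> hG; elim: hG z w => [pq|{}G v a b hG IH vG aG bG ab nab] z w.
  by rewrite /adj inE.
have [pq pG qG npq] := hen_base hG; have sG := hen_simple hG.
have pv : p != v by apply: contraNneq vG => <-.
have qv : q != v by apply: contraNneq vG => <-.
rewrite inE negb_or; have [->|wv] := eqVneq w v.
  rewrite !adj_ext_new // => pab qab /andP[zv zG].
  have -> : ext G v a b = ext G v p q.
    case/orP: pab qab => /eqP E /orP[]/eqP E'; move: pq; rewrite E E' ?eqxx //.
    by rewrite extC.
  by rewrite inE in zv; apply: hen_rebase.
rewrite !adj_ext_old // inE => wp wq /andP[zv zG].
have nz t : t \in verts G -> t != z by apply: contraTneq => ->.
rewrite ext_comm; apply: henS (IH _ _ wp wq zG) _ _ _ ab _;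
  rewrite ?inE ?aG ?bG ?orbT //; first by rewrite negb_or eq_sym zv.
by rewrite adj_ext_old ?nz.
Qed.

Lemma adj_pairg x y a b : adj (pairg x y) a b = false.
Proof. by rewrite /adj inE. Qed.

Lemma adj_C4 x y a b c d : adj (C4 x y a b) c d =
  (c \in [:: x; y]) && (d \in [:: a; b]) || (c \in [:: a; b]) && (d \in [:: x; y]).
Proof.
rewrite !adj_ext adj_pairg !inE.
by do 8 case: (_ == _).
Qed.

Lemma codeg2_C4 x y a b u w : uniq [:: x; y; a; b] -> codeg2 (C4 x y a b) u w ->
  [set u; w] = [set x; y] \/ [set u; w] = [set a; b].
Proof.
move=> U [uw [c [d [_ uc wc _ _]]]].
have: (u \in [:: x; y]) && (w \in [:: x; y]) || (u \in [:: a; b]) && (w \in [:: a; b]).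
  have ncc : ~~ ((c \in [:: x; y]) && (c \in [:: a; b])).
    move: U; rewrite -[_ :: _]/([:: x; y] ++ [:: a; b]) cat_uniq => /and3P[_ + _].
    by move/hasPn => D; apply/negP => /andP[cxy /D]; rewrite cxy.
  move: uc wc ncc; rewrite !adj_C4.
  by do 6 case: (_ \in _).
rewrite !inE => /orP[]/andP[/orP[]/eqP E /orP[]/eqP E']; move: uw;
  rewrite E E' ?eqxx // => _; by [left | right | left; rewrite setUC | right; rewrite setUC].
Qed.

Lemma hen_set2 G u w x y : [set u; w] = [set x; y] -> hen x y G -> hen u w G.
Proof.
by move=> /eqP; rewrite set2_eqE => /orP[]/andP[/eqP-> /eqP->] // /hen_sym.
Qed.

(** A pair containing the newest vertex [z] consists of [z] and a vertex adjacent to both neighbors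
    [p], [q] of [z], the case of [hen_twin]. A pair of older vertices either had its two common
    neighbors before [z] came, or is [p], [q] itself. *)
Lemma quad_hen G u w : quad G -> codeg2 G u w -> hen u w G.
Proof.
move=> qG; elim: qG u w => [x y a b U|{}G z p q qG IH zG tpq] u w.
  move=> /(codeg2_C4 U)[] /hen_set2; apply; first exact: hen_C4.
  rewrite C4_swap; apply: hen_C4; move: U.
  by rewrite /= !inE !negb_or !andbT [x == a]eq_sym [x == b]eq_sym [y == a]eq_sym
    [y == b]eq_sym => /and3P[/and3P[-> -> ->] /andP[-> ->] ->].
have sG := quad_simple qG; have tfG := quad_triangle_free qG.
have [pq pG qvG] := simple_codeg2_verts sG tpq.
have nz t : t \in verts G -> t != z by apply: contraTneq => ->.
have [pz qz] := (nz _ pG, nz _ qvG).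
have new t : codeg2 (ext G z p q) z t -> hen z t (ext G z p q).
  move=> [zt [c [d [cd]]]]; rewrite !adj_ext_new // => zc tc zd td.
  have [tp tq] : adj G t p /\ adj G t q.
    have tz : t != z by rewrite eq_sym.
    case/orP: zc zd tc td cd => /eqP-> /orP[]/eqP->; rewrite ?eqxx ?adj_ext_old // => -> ->; by [].
  exact: hen_twin (IH _ _ tpq) tp tq zG.
have [->|uz] := eqVneq u z; first exact: new.
have [->|wz] := eqVneq w z; first by move/codeg2C/new/hen_sym.
move=> t.
have tG : codeg2 G u w.
  case: t => uw [c [d [cd uc wc ud wd]]].
  have [Eu|cdz] := boolP ((c == z) || (d == z)).
    have uwpq : (u \in [:: p; q]) && (w \in [:: p; q]).
      rewrite !inE; case/orP: Eu => /eqP E; rewrite E in uc wc ud wd;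
      [move: uc wc | move: ud wd]; by rewrite ![adj _ _ z]adjC !adj_ext_new // => -> ->.
    move: uwpq uw; rewrite !inE => /andP[/orP[]/eqP-> /orP[]/eqP->]; rewrite ?eqxx //.
    by move=> _; apply: codeg2C.
  move: cdz; rewrite negb_or => /andP[cz dz]; split=> //; exists c, d.
  by move: uc wc ud wd; rewrite !adj_ext_old.
exact: henS (IH _ _ tG) zG pG qvG pq (codeg2_nadj tfG tpq).
Qed.

Lemma nadj_pair_P3 x y a u w : x != y -> a != x -> a != y ->
  u \in verts (ext (pairg x y) a x y) -> w \in verts (ext (pairg x y) a x y) ->
  u != w -> ~~ adj (ext (pairg x y) a x y) u w -> [set u; w] = [set x; y].
Proof.
move=> xy ax ay; rewrite adj_ext adj_pairg !inE.
case: (eqVneq u a) => [->|ua] /=; first by rewrite [_ == a]eq_sym !(eq_sym w) => _ /or3P[]/eqP->; rewrite ?eqxx ?orbT.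
by move=> /orP[]/eqP-> /or3P[]/eqP->; rewrite ?eqxx ?orbT //= => _ _; rewrite setUC.
Qed.

Lemma ext_set2 G v u w x y : [set u; w] = [set x; y] -> ext G v u w = ext G v x y.
Proof.
by move=> /eqP; rewrite set2_eqE => /orP[]/andP[/eqP-> /eqP->] //; rewrite extC.
Qed.

Lemma codeg2_set2 G u w x y : [set u; w] = [set x; y] -> codeg2 G x y -> codeg2 G u w.
Proof.
by move=> /eqP; rewrite set2_eqE => /orP[]/andP[/eqP-> /eqP->] // /codeg2C.
Qed.

Lemma set2_pair u w x y : u \in [set x; y] -> w \in [set x; y] -> u != w ->
  [set u; w] = [set x; y].
Proof.
by rewrite !inE => /orP[]/eqP-> /orP[]/eqP->; rewrite ?eqxx // => _; rewrite setUC.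
Qed.

Lemma card_ext G v u w : v \notin verts G -> #|verts (ext G v u w)| = #|verts G|.+1.
Proof. by move=> vG; rewrite cardsU1 vG. Qed.

Lemma codeg2_new2 G a b u w : a \notin verts G -> b \notin verts G -> a != b ->
  u \in verts G -> w \in verts G -> u != w -> simple_graph G ->
  codeg2 (ext (ext G a u w) b u w) u w.
Proof.
move=> aG bG ab uG wG uw sG; split=> //; exists a, b.
by rewrite !adj_ext !eqxx !orbT.
Qed.

(** The first step is on [u], [w], and so is the second, since these are the only nonadjacent
    vertices of the path then reached. The two vertices added remain common neighbors. *)
Lemma hen_cases G u w : hen u w G ->
  [\/ G = pairg u w,
      exists v, [/\ v != u, v != w & G = ext (pairg u w) v u w] | codeg2 G u w].
Proof.
elim=> [uw|{}G v a b hG IH vG aG bG ab nab]; first by constructor 1.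
have [uw uG wG _] := hen_base hG.
case: IH => [E|[c [cu cw E]]|t]; last by constructor 3; apply: codeg2W.
- constructor 2; exists v; move: vG aG bG; rewrite E !inE negb_or => /andP[vu vw] aG bG.
  by split=> //; apply: ext_set2; apply: set2_pair; rewrite ?inE.
- constructor 3; rewrite E in aG bG nab vG *.
  rewrite (ext_set2 _ _ (nadj_pair_P3 uw cu cw aG bG ab nab)).
  move: vG; rewrite !inE !negb_or => /and3P[vc vu vw].
  by apply: codeg2_new2; rewrite ?inE ?negb_or ?eqxx ?orbT ?cu ?vu // 1?eq_sym //; exact: simple_pairg.
Qed.

Lemma hen_codeg2 G u w : hen u w G -> 4 <= #|verts G| -> codeg2 G u w.
Proof.
move=> hG; have [uw _ _ _] := hen_base hG; case: (hen_cases hG) => // [->|[v [vu vw ->]]].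
  by rewrite cards2 uw.
by rewrite card_ext ?cards2 ?uw // !inE negb_or vu.
Qed.

Lemma quad_card G : quad G -> 4 <= #|verts G|.
Proof.
elim=> [x y a b U|{}G v u w _ IH vG _]; last by rewrite card_ext // ltnW.
have -> : verts (C4 x y a b) = [set z in [:: x; y; a; b]].
  by apply/setP => z; rewrite !inE; do 4 case: (z == _).
by rewrite cardsE (card_uniqP U).
Qed.

Lemma uniq4 x y a b : x != y -> a != x -> a != y -> b != x -> b != y -> b != a ->
  uniq [:: x; y; a; b].
Proof.
move=> xy ax ay bx b_y ba.
rewrite /= !inE !negb_or !andbT xy [x == a]eq_sym ax [x == b]eq_sym bx.
by rewrite [y == a]eq_sym ay [y == b]eq_sym b_y eq_sym ba.
Qed.

(* The graphs all of whose extreme graphs are tree-decomposable. *)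
Definition stacked G : Prop :=
  [\/ exists x y, x != y /\ G = pairg x y,
      exists x y a, [/\ x != y, a != x, a != y & G = ext (pairg x y) a x y]
    | quad G].

Lemma stackedS G v u w : stacked G -> hen u w G -> v \notin verts G ->
  stacked (ext G v u w).
Proof.
move=> sG hG vG; have [uw uG wG nuw] := hen_base hG.
case: sG => [[x [y [xy E]]]|[x [y [a [xy ax ay E]]]]|qG].
- move: vG uG wG; rewrite E !inE negb_or => /andP[vx vy] uG wG.
  constructor 2; exists x, y, v; split=> //; apply: ext_set2; apply: set2_pair; by rewrite ?inE.
- constructor 3; rewrite E in uG wG nuw vG *.
  rewrite (ext_set2 _ _ (nadj_pair_P3 xy ax ay uG wG uw nuw)).
  move: vG; rewrite !inE !negb_or => /and3P[va vx vy].
  by apply: quad0; apply: uniq4.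
- by constructor 3; apply: quadS => //; apply: hen_codeg2 (quad_card qG).
Qed.

Lemma stacked_quad G : stacked G -> 4 <= #|verts G| -> quad G.
Proof.
case=> // [[x [y [xy ->]]]|[x [y [a [xy ax ay ->]]]]]; first by rewrite cards2 xy.
by rewrite card_ext ?cards2 ?xy // !inE negb_or ax.
Qed.

Definition del G z : sgraph V :=
  SGraph (verts G :\ z) [set e in edges G | z \notin e].

Lemma del_ext G z u w : simple_graph G -> z \notin verts G -> del (ext G z u w) z = G.
Proof.
move=> sG zG; apply: sgraph_eq => /=; first by rewrite setU1K.
apply/setP => e; rewrite !inE.
have nz c : ([set z; c] \in edges G) = false.
  by apply: contraNF zG => /(simple_adj sG)[].
case: (eqVneq e [set z; u]) => [->|_]; first by rewrite nz /= !inE eqxx.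
case: (eqVneq e [set z; w]) => [->|_]; first by rewrite nz /= !inE eqxx.
rewrite /=; have [eG|//] := boolP (e \in edges G).
by apply: contraNN zG => /(subsetP (sG e eG).2).
Qed.

Lemma del_ext_neq G z v u w : z != v -> z != u -> z != w ->
  del (ext G v u w) z = ext (del G z) v u w.
Proof.
move=> zv zu zw; apply: sgraph_eq => /=.
  apply/setP => c; rewrite !inE; case: (eqVneq c v) => [->|//]; by rewrite eq_sym zv.
apply/setP => e; rewrite !inE.
case: (eqVneq e [set v; u]) => [->|_]; first by rewrite /= !inE negb_or zv zu.
by case: (eqVneq e [set v; w]) => [->|_]; first by rewrite /= !inE negb_or zv zw.
Qed.

Lemma ext_del G z u w : simple_graph G -> z \in verts G ->
  (forall c, adj G z c = (c == u) || (c == w)) -> G = ext (del G z) z u w.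
Proof.
move=> sG zG N; apply: sgraph_eq => /=; first by rewrite setD1K.
apply/setP => e; rewrite !inE.
have [eG|eG] := boolP (e \in edges G); last first.
  rewrite orbF; apply/esym/negbTE; rewrite negb_or; apply/andP; split;
  by apply: contraNneq eG => ->; rewrite -/(adj _ _ _) N eqxx ?orbT.
have [ze|//] := boolP (z \in e); last by rewrite !orbT.
have [/eqP/cards2P[a [b [ab E]]] _] := sG e eG.
have [c Ec] : exists c, e = [set z; c].
  move: ze; rewrite E !inE => /orP[]/eqP->; [by exists b | by exists a; rewrite setUC].
move: eG; rewrite Ec -/(adj _ _ _) N => /orP[]/eqP->; by rewrite eqxx ?orbT.
Qed.

Lemma quad_deg G z : quad G -> z \in verts G ->
  exists c d, [/\ c != d, adj G z c & adj G z d].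
Proof.
move=> qG; elim: qG z => [x y a b U|{}G v u w qG IH vG t] z.
  move: U; rewrite /= !inE !negb_or => /and4P[/and3P[xy _ _] _ ab _].
  move=> zin; have [zxy|zxy] := boolP (z \in [:: x; y]).
    exists a, b; rewrite !adj_C4 zxy !inE !eqxx ?orbT; split=> //.
  exists x, y; rewrite !adj_C4 !inE !eqxx ?orbT /= !andbT; split=> //.
    by move: zin zxy; rewrite !inE negb_or; do 4 case: (z == _).
  by move: zin zxy; rewrite !inE negb_or; do 4 case: (z == _).
have sG := quad_simple qG; have [uw uG wG] := simple_codeg2_verts sG t.
rewrite !inE => /orP[/eqP->|/IH[c [d [cd zc zd]]]].
  by exists u, w; rewrite !adj_ext_new // !eqxx orbT.
by exists c, d; split=> //; apply: adj_extW.
Qed.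

(** Base case of the deletion: [z] and [v] have the same neighbors [x], [y], so [v] takes the place
    of [z] in the 4-cycle. *)
Lemma quad_del_C4 x y a z v p q u w : uniq [:: x; y; a; z] ->
  v \notin verts (C4 x y a z) -> [set p; q] = [set x; y] ->
  (forall c, adj (C4 x y a z) z c = (c == u) || (c == w)) -> 
  let G' := ext (del (C4 x y a z) z) v p q in quad G' /\ codeg2 G' u w.
Proof.
move=> U vC pq N; have /= := U; rewrite !inE !negb_or !andbT.
move=> /and3P[/and3P[xy xa xz] /andP[ya yz] az].
move: vC; rewrite !inE !negb_or => /and4P[vz va vx vy].
have sP : simple_graph (ext (pairg x y) a x y).
  by apply: simple_ext (@simple_pairg _ x y) _ _ _; rewrite !inE ?negb_or ?[a == _]eq_sym ?xa ?eqxx ?orbT.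
have zP : z \notin verts (ext (pairg x y) a x y).
  by rewrite !inE !negb_or ![z == _]eq_sym az xz yz.
have uw : [set u; w] = [set x; y].
  by apply/setP => c; rewrite !inE -N /C4 adj_ext_new // !inE eqxx ?orbT.
rewrite /= (ext_set2 _ _ pq) del_ext //; split.
  by apply: quad0; apply: uniq4; rewrite // eq_sym.
apply: codeg2_set2 uw _; apply: codeg2_new2 => //; rewrite ?inE ?negb_or ?eqxx ?orbT ?vx //.
- by rewrite eq_sym xa eq_sym ya.
- by rewrite eq_sym.
- exact: simple_pairg.
Qed.

Lemma C4_comm x y a b : C4 x y a b = C4 x y b a.
Proof. exact: ext_comm. Qed.

(** If the last step adds another vertex [v], it commutes with the deletion of [z], and the
    induction hypothesis applies below it. This is what makes the property independent of the
    construction. *)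
Lemma quad_del G G' z u w : quad G -> G = ext G' z u w -> simple_graph G' ->
  z \notin verts G' -> u \in verts G' -> w \in verts G' -> u != w ->
  4 <= #|verts G'| -> quad G' /\ codeg2 G' u w.
Proof.
move=> qG; elim: qG G' => [x y a b U|G1 v p q qG1 IH vG1 t] G' E sG' zG' uG' wG' uw card4.
  have := card_ext u w zG'; rewrite -E.
  have -> : verts (C4 x y a b) = [set c in [:: x; y; a; b]].
    by apply/setP => c; rewrite !inE; do 4 case: (c == _).
  by rewrite cardsE (card_uniqP U) => -[] F; rewrite -F in card4.
have sG1 := quad_simple qG1; have [pq pG1 qvG1] := simple_codeg2_verts sG1 t.
have Nz c : adj (ext G1 v p q) z c = (c == u) || (c == w) by rewrite E adj_ext_new.
have [Ev|vz] := eqVneq v z.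
  have E1 : G1 = G' by rewrite -(del_ext p q sG1 vG1) E Ev del_ext.
  rewrite -E1; split=> //; apply: codeg2_set2 t; apply/setP => c.
  by rewrite !inE -Nz -Ev adj_ext_new.
have zG1 : z \in verts G1.
  have : z \in verts (ext G1 v p q) by rewrite E !inE eqxx.
  by rewrite !inE eq_sym (negPf vz).
(* [z] has two neighbors in [G1] already; as a base vertex of the last step it would get [v] as a
   third. *)
have zpq : ~~ ((z == p) || (z == q)).
  apply/negP => zpq; have [c [d [cd zc zd]]] := quad_deg qG1 zG1.
  have cv : c != v by apply: contraNneq vG1 => <-; case: (simple_adj sG1 zc).
  have dv : d != v by apply: contraNneq vG1 => <-; case: (simple_adj sG1 zd).
  have /esym dd : true = _ := etrans (esym (adj_extW v p q zd)) (Nz d).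
  have /esym cc : true = _ := etrans (esym (adj_extW v p q zc)) (Nz c).
  have := Nz v; rewrite adjC adj_ext_new // zpq => /esym vv.
  by move: cd cv dv; case/orP: dd cc vv => /eqP-> /orP[]/eqP-> /orP[]/eqP->; rewrite ?eqxx.
have Nz1 c : adj G1 z c = (c == u) || (c == w).
  have [->|cv] := eqVneq c v; last by rewrite -Nz adj_ext_old // eq_sym.
  rewrite -Nz adjC [RHS]adjC adj_ext_new // (negPf zpq).
  by apply: contraNF vG1 => /(simple_adj sG1)[].
move: (zpq); rewrite negb_or => /andP[zp zq].
have EG' : G' = ext (del G1 z) v p q.
  by rewrite -del_ext_neq // 1?eq_sym // E del_ext.
(* With four vertices left the induction hypothesis applies; otherwise [G1] is a 4-cycle. *)
have [four|big] := leqP #|verts (del G1 z)| 3; last first.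
  have [||||||q2 t2] := IH (del G1 z) (ext_del sG1 zG1 Nz1) => //.
  - by move=> e; rewrite !inE => /andP[/sG1[e2 /subsetP es] ze]; split=> //;
      apply/subsetP => c ce; rewrite !inE es // andbT; apply: contraNneq ze => <-.
  - by rewrite !inE eqxx.
  - have : adj G1 z u by rewrite Nz1 eqxx.
    by case/(simple_adj sG1) => zu _ uG; rewrite !inE uG eq_sym zu.
  - have : adj G1 z w by rewrite Nz1 eqxx orbT.
    by case/(simple_adj sG1) => zu _ uG; rewrite !inE uG eq_sym zu.
  rewrite EG'; split; last exact: codeg2W.
  apply: quadS => //; first by rewrite !inE (negPf vG1) andbF.
  (* If [z] is a common neighbor of [p] and [q], then these are [u] and [w], which keep two common
     neighbors by the induction hypothesis; otherwise the common neighbors of [p], [q] survive. *)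
  have [/eqP pquw|npquw] := boolP ([set p; q] == [set u; w]); first exact: codeg2_set2 t2.
  case: t => _ [c [d [cd pc qc pd qd]]]; split=> //; exists c, d.
  have ok s : adj G1 p s -> adj G1 q s -> s != z.
    move=> ps qs; apply: contraNneq npquw => Es; rewrite Es adjC Nz1 in ps.
    rewrite Es adjC Nz1 in qs.
    by apply/eqP; apply: set2_pair; rewrite ?inE.
  have okd s s' : adj G1 s s' -> s != z -> s' != z -> adj (del G1 z) s s'.
    by rewrite /adj !inE negb_or ![z == _]eq_sym => -> -> ->.
  have [pz qz] : p != z /\ q != z by split; rewrite eq_sym.
  by split=> //; apply: okd => //; exact: ok.
have qcard := quad_card qG1.
have c4 : #|verts G1| = 4.
  by apply/eqP; rewrite eqn_leq qcard andbT (cardsD1 z) zG1.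
case: qG1 EG' c4 vG1 t zG1 Nz1 {IH four qcard sG1 pG1 qvG1 Nz E}; last first.
  by move=> G2 v2 p2 q2 qG2 vG2 _ _; rewrite card_ext // => -[] c3; have := quad_card qG2; rewrite c3.
move=> x y a b U -> _ vC t zC Nz1.
(* By the symmetries of the 4-cycle, one may assume that [v] is joined to one side and that [z] is
   on the other. *)
have gen x' y' a' b' : uniq [:: x'; y'; a'; b'] -> C4 x y a b = C4 x' y' a' b' ->
    [set p; q] = [set x'; y'] ->
    quad (ext (del (C4 x y a b) z) v p q) /\ codeg2 (ext (del (C4 x y a b) z) v p q) u w.
  move=> U' EC pqE; rewrite EC in vC zC Nz1 *.
  have: (z == b') || (z == a').
    have: z \notin [set x'; y'] by rewrite -pqE !inE.
    by move: zC; rewrite !inE; do 4 case: (z == _).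
  case/orP => /eqP Ez; rewrite Ez in zC Nz1 *; first exact: quad_del_C4.
  rewrite C4_comm in vC Nz1 *; apply: quad_del_C4 => //.
  move: U'; rewrite /= !inE !negb_or !andbT [b' == _]eq_sym.
  by move=> /and3P[/and3P[-> -> ->] /andP[-> ->] ->].
case: (codeg2_C4 U t) => pqE; first exact: (gen x y a b).
apply: (gen a b x y) => //; last exact: C4_swap.
move: U; rewrite /= !inE !negb_or !andbT ![a == _]eq_sym ![b == _]eq_sym.
by move=> /and3P[/and3P[-> -> ->] /andP[-> ->] ->].
Qed.

End Quad.

(** * Tree-decomposable graphs and triangle-freeness *)

Section TreeDec.
Variable V : finType.
Implicit Types (G H T A B C : sgraph V) (a b c d u v w x y z : V).

(** The step adding [v] is a union of three pieces, the graph with its base edge and the edges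
    [v a], [v b], which meet pairwise in [a], [b] and [v]. *)
Lemma hen_tree_dec u w G : hen u w G -> tree_dec (add_edge G u w).
Proof.
elim=> [uw|{}G v a b hG IH vG aG bG ab nab].
  by rewrite /add_edge setU0; exact: tree_dec_edge.
have av : a != v by apply: contraNneq vG => <-.
have bv : b != v by apply: contraNneq vG => <-.
have -> : add_edge (ext G v a b) u w =
    gunion (gunion (add_edge G u w) (edge_graph v a)) (edge_graph v b).
  apply: sgraph_eq; apply/setP => e; rewrite !inE /=.
    have [->|ea] := eqVneq e a; first by rewrite aG !orbT.
    have [->|eb] := eqVneq e b; first by rewrite bG !orbT.
    by case: (e == v); rewrite ?orbT ?orbF.
  by case: (e \in edges G); do 3 case: (e == _).
have cap t : t \in verts G -> verts G :&: [set v; t] = [set t].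
  move=> tG; apply/setP => e; rewrite !inE.
  have [->|ev] := eqVneq e v; last by case: eqVneq => [->|]; rewrite ?tG ?andbF.
  by rewrite (negPf vG); apply/esym/negbTE; apply: contraNneq vG => ->.
apply: (tree_dec_union (a := v) (b := b) (c := a)) => //=; rewrite ?cap //.
- by apply: tree_dec_edge; rewrite eq_sym.
- by apply: tree_dec_edge; rewrite eq_sym.
- apply/setP => e; rewrite !inE; case: (e == v) => //=.
  by apply/negbTE/negP => /andP[/eqP-> /eqP E]; rewrite E eqxx in ab.
- by rewrite !inE negb_or ![v == _]eq_sym av bv eq_sym ab.
Qed.

Lemma tree_dec_simple T : tree_dec T -> simple_graph T.
Proof.
elim=> [x y xy|A B C a b c _ sA _ sB _ sC _ _ _ _] e /=.
  by rewrite inE => /eqP->; rewrite cards2 xy.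
rewrite !inE => /orP[/orP[]|] => [/sA|/sB|/sC] [-> /subsetP eT]; split=> //;
  by apply/subsetP => z /eT; rewrite !inE => ->; rewrite ?orbT.
Qed.

Lemma no_K3_triangle_free G : simple_graph G -> ~ has_K3 G -> triangle_free G.
Proof.
move=> sG nK a b c ab bc ac; apply: nK; exists a, b, c; split=> //.
have [nab _ _] := simple_adj sG ab; have [nbc _ _] := simple_adj sG bc.
by have [nac _ _] := simple_adj sG ac; rewrite /= !inE negb_or nab nac nbc.
Qed.

Lemma triangle_free_sub G H : subgraph H G -> triangle_free G -> triangle_free H.
Proof.
by move=> [_ /subsetP sub] tf a b c /sub ab /sub bc /sub ac; apply: (tf a b c).
Qed.

Lemma subgraph_trans G H T : subgraph G H -> subgraph H T -> subgraph G T.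
Proof. by move=> [a b] [c d]; split; [apply: subset_trans c | apply: subset_trans d]. Qed.

Lemma edge_graph_mem x y a b : a \in [set x; y] -> b \in [set x; y] -> a != b ->
  edge_graph x y = edge_graph a b.
Proof. by move=> ax bx ab; rewrite /edge_graph (set2_pair ax bx ab). Qed.

(** By induction, the parts of a union would be three edges meeting pairwise in distinct vertices,
    that is, a triangle. *)
Lemma tree_dec_triangle_free T : tree_dec T -> triangle_free T ->
  exists x y, x != y /\ T = edge_graph x y.
Proof.
elim=> [x y xy _|A B C a b c _ IA _ IB _ IC BC AC AB U tf]; first by exists x, y.
have [[sA sB] sC] : (subgraph A (gunion (gunion A B) C) /\
    subgraph B (gunion (gunion A B) C)) /\ subgraph C (gunion (gunion A B) C).
  by split; [split|]; split=> /=; apply/subsetP => z; rewrite !inE => ->; rewrite ?orbT.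
have [xA [yA [_ EA]]] := IA (triangle_free_sub sA tf).
have [xB [yB [_ EB]]] := IB (triangle_free_sub sB tf).
have [xC [yC [_ EC]]] := IC (triangle_free_sub sC tf).
move: U; rewrite /= !inE negb_or andbT => /andP[/andP[ab ac] bc].
have /setIP[aB aC] : a \in verts B :&: verts C by rewrite BC set11.
have /setIP[bA bC] : b \in verts A :&: verts C by rewrite AC set11.
have /setIP[cA cB] : c \in verts A :&: verts B by rewrite AB set11.
rewrite EA in bA cA; rewrite EB in aB cB; rewrite EC in aC bC.
case: (tf a b c); rewrite /adj !inE EA EB EC /= !inE.
- by rewrite (set2_pair aC bC ab) eqxx !orbT.
- by rewrite (set2_pair bA cA bc) eqxx.
- by rewrite (set2_pair aB cB ac) eqxx !orbT.
Qed.

Definition rem_edge G u w : sgraph V := SGraph (verts G) (edges G :\ [set u; w]).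

(** The edge [u w] lies in [A] only. So [B] and [C] are triangle-free, hence the single edges [a c]
    and [a b], and the union is a step that adds [a] to [A]; an edge [b c] would close a
    triangle. *)
Lemma union_hen A B C a b c u w : tree_dec A -> tree_dec B -> tree_dec C ->
  verts B :&: verts C = [set a] -> verts A :&: verts C = [set b] ->
  verts A :&: verts B = [set c] -> uniq [:: a; b; c] ->
  adj A u w -> (triangle_free (rem_edge A u w) -> hen u w (rem_edge A u w)) ->
  triangle_free (rem_edge (gunion (gunion A B) C) u w) ->
  hen u w (rem_edge (gunion (gunion A B) C) u w).
Proof.
move=> tA tB tC BC AC AB; rewrite /= !inE negb_or andbT => /andP[/andP[ab ac] bc] Auw IH tf.
have [sA sB sC] := And3 (tree_dec_simple tA) (tree_dec_simple tB) (tree_dec_simple tC).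
have [uw uA wA] := simple_adj sA Auw.
have nB : ~~ adj B u w.
  apply/negP => /(simple_adj sB)[_ uB wB]; move: uw.
  have /set1P-> : u \in [set c] by rewrite -AB inE uA.
  have /set1P-> : w \in [set c] by rewrite -AB inE wA.
  by rewrite eqxx.
have nC : ~~ adj C u w.
  apply/negP => /(simple_adj sC)[_ uB wB]; move: uw.
  have /set1P-> : u \in [set b] by rewrite -AC inE uA.
  have /set1P-> : w \in [set b] by rewrite -AC inE wA.
  by rewrite eqxx.
have ne (H : sgraph V) e : ~~ adj H u w -> e \in edges H -> e != [set u; w].
  by move=> nH eH; apply: contraNneq nH => E; rewrite /adj -E.
have tfB : triangle_free B.
  apply: triangle_free_sub tf; split; apply/subsetP => e; rewrite !inE => eB; rewrite eB ?orbT //.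
  by rewrite (ne B).
have tfC : triangle_free C.
  apply: triangle_free_sub tf; split; apply/subsetP => e; rewrite !inE => eC; rewrite eC ?orbT //.
  by rewrite (ne C).
have [xB [yB [_ EB]]] := tree_dec_triangle_free tB tfB.
have [xC [yC [_ EC]]] := tree_dec_triangle_free tC tfC.
have /setIP[aB aC] : a \in verts B :&: verts C by rewrite BC set11.
have /setIP[bA bC] : b \in verts A :&: verts C by rewrite AC set11.
have /setIP[cA cB] : c \in verts A :&: verts B by rewrite AB set11.
have aA : a \notin verts A.
  by apply: contraNN ac => aA; rewrite -in_set1 -AB inE aA.
have EB' : B = edge_graph a c by rewrite EB; rewrite EB in aB cB; exact: edge_graph_mem.
have EC' : C = edge_graph a b by rewrite EC; rewrite EC in aC bC; exact: edge_graph_mem.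
have ea d : [set a; d] != [set u; w].
  apply: contraNneq aA => /setP/(_ a); rewrite !inE eqxx => /esym/orP[]/eqP-> //.
have E : rem_edge (gunion (gunion A B) C) u w = ext (rem_edge A u w) a c b.
  rewrite EB' EC'; apply: sgraph_eq; apply/setP => e; rewrite !inE /=.
    have [->|ec] := eqVneq e c; first by rewrite cA !orbT.
    have [->|eb] := eqVneq e b; first by rewrite bA !orbT.
    by case: (e == a); rewrite ?orbT ?orbF.
  have [->|e1] := eqVneq e [set a; c]; first by rewrite ea !orbT.
  have [->|e2] := eqVneq e [set a; b]; first by rewrite ea !orbT.
  by rewrite !orbF.
have tfA : triangle_free (rem_edge A u w).
  apply: triangle_free_sub tf; split; apply/subsetP => e; rewrite !inE; first by move->.
  by move=> /andP[-> ->].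
have cb : c != b by rewrite eq_sym.
rewrite E in tf *; apply: henS (IH tfA) aA cA bA cb _.
apply/negP => cbA; apply: (tf a c b).
- by rewrite adj_ext !eqxx !orbT.
- exact: adj_extW.
- by rewrite adj_ext !eqxx !orbT.
Qed.

(** Converse of [hen_tree_dec]. Triangle-freeness is asked without the edge [u w], as a base edge
    may create triangles. *)
Lemma tree_dec_hen T u w : tree_dec T -> adj T u w ->
  triangle_free (rem_edge T u w) -> hen u w (rem_edge T u w).
Proof.
elim=> [x y xy|A B C a b c tA IA tB IB tC IC BC AC AB U].
  rewrite /adj inE => /eqP E _.
  have uw : u != w.
    have : #|[set x; y]| = 2 by rewrite cards2 xy.
    by rewrite -E cards2; case: (u != w).
  rewrite /rem_edge /= E setDv -/(pairg x y).
  by apply: hen_set2 E _; exact: hen0.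
rewrite {1}/adj !inE => /orP[/orP[]|] e.
- exact: (union_hen tA tB tC BC AC AB U e (IA e)).
- have -> : gunion (gunion A B) C = gunion (gunion B A) C.
    by apply: sgraph_eq; rewrite /= (setUC (_ A)).
  apply: (@union_hen B A C b a c u w) => //; rewrite 1?setIC //; last exact: IB.
  by move: U; rewrite /= !inE !negb_or !andbT (eq_sym b a) => /andP[/andP[-> ->] ->].
- have -> : gunion (gunion A B) C = gunion (gunion C B) A.
    by apply: sgraph_eq; rewrite /= [RHS]setUC -setUA; congr (_ :|: _); exact: setUC.
  apply: (@union_hen C B A c b a u w) => //; rewrite 1?setIC //; last exact: IC.
  by move: U; rewrite /= !inE !negb_or !andbT ![c == _]eq_sym (eq_sym b a) => /andP[/andP[-> ->] ->].
Qed.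

End TreeDec.

(** * Stages and extreme graphs of a triangle-free graph *)

Section Construction.
Variable V : finType.
Implicit Types (G H T : sgraph V) (a b c d u v w x y z : V).
Implicit Types (s : seq (cstep V)) (st : cstep V).

Lemma onth_size (T : Type) (s : seq T) k t : onth s k = Some t -> k < size s.
Proof. by rewrite ltnNge => E; apply/negP => le; rewrite onth_default in E. Qed.

Lemma stage0 x y s : stage x y s 0 = pairg x y.
Proof. by rewrite /stage take0. Qed.

Lemma stageS x y s k st : onth s k = Some st ->
  stage x y s k.+1 = append_step (stage x y s k) st.
Proof.
rewrite /stage; elim: s k (SGraph _ _) => [|t s IH] [|k] H //=.
  by move=> [->]; rewrite take0.
exact: IH.
Qed.

Lemma onth_lt (T : Type) (s : seq T) k : k < size s -> exists t, onth s k = Some t.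
Proof.
by elim: s k => [|t s IH] [|k] //= lt; [exists t | apply: IH].
Qed.

Lemma stage_subgraph x y s k m : k <= m <= size s ->
  subgraph (stage x y s k) (stage x y s m).
Proof.
elim: m => [|m IH]; first by rewrite leqn0 => /andP[/eqP->].
rewrite leq_eqVlt => /andP[/orP[/eqP->//|km] ms].
have [st E] := onth_lt ms; rewrite (stageS _ _ E).
apply: subgraph_trans (IH _) _; first by rewrite -ltnS km ltnW.
by split; apply/subsetP => z; rewrite !inE => ->.
Qed.

Lemma cluster_edge G T : triangle_free G -> is_cluster G T ->
  exists x y, x != y /\ T = edge_graph x y.
Proof.
by move=> tf [sub tT _]; apply: tree_dec_triangle_free tT (triangle_free_sub sub tf).
Qed.

Definition step_graph H st : sgraph V :=
  ext H (step_vertex st) (left_base st) (right_base st).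

(** Both clusters are single edges through the step vertex, so the step is a Henneberg step and adds
    this vertex only. *)
Lemma valid_step_ext G H st : triangle_free G -> valid_step G H st ->
  let: CStep v u w _ _ := st in
  [/\ v \notin verts H, u \in verts H, w \in verts H, u != w &
      append_step H st = ext H v u w /\ added st = [set v]].
Proof.
case: st => v u w L R tf [[/(cluster_edge tf) [xL [yL [_ EL]]] /(cluster_edge tf)[xR [yR [_ ER]]]]].
rewrite /= in EL ER *; rewrite /added /append_step /= EL ER => LR LH RH uw.
have /setIP[vL vR] : v \in verts (edge_graph xL yL) :&: verts (edge_graph xR yR).
  by rewrite LR set11.
have /setIP[uL uH] : u \in verts (edge_graph xL yL) :&: verts H by rewrite LH set11.
have /setIP[wR wH] : w \in verts (edge_graph xR yR) :&: verts H by rewrite RH set11.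
have vH : v \notin verts H.
  apply/negP => vH; case/negP: uw.
  have /set1P<- : v \in [set u] by rewrite -LH inE vL.
  by have /set1P<- : v \in [set w] by rewrite -RH inE vR.
have vu : v != u by apply: contraNneq vH => ->.
have vw : v != w by apply: contraNneq vH => ->.
rewrite (edge_graph_mem vL uL vu) (edge_graph_mem vR wR vw); split=> //; split.
  apply: sgraph_eq; apply/setP => e; rewrite !inE.
    have [->|eu] := eqVneq e u; first by rewrite uH !orbT.
    have [->|ew] := eqVneq e w; first by rewrite wH !orbT.
    by case: (e == v); rewrite ?orbT ?orbF.
  by case: (e \in edges H); do 2 case: (e == _).
apply/setP => e; rewrite !inE negb_or.
have [->|ev] := eqVneq e v; first by rewrite vu vw.
by case: (e == u); case: (e == w).
Qed.

Lemma codeg2_card G u w : simple_graph G -> codeg2 G u w -> 4 <= #|verts G|.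
Proof.
move=> sG [uw [c [d [cd uc wc ud wd]]]].
have [nuc uG cG] := simple_adj sG uc; have [nwc wG _] := simple_adj sG wc.
have [nud _ dG] := simple_adj sG ud; have [nwd _ _] := simple_adj sG wd.
have U : uniq [:: u; w; c; d] by apply: uniq4; rewrite // eq_sym.
rewrite -[4]/(size [:: u; w; c; d]) -(card_uniqP U); apply: subset_leq_card.
by apply/subsetP => z; rewrite !inE => /or4P[]/eqP->.
Qed.

Section FixedConstruction.
Variables (G : sgraph V) (x y : V) (s : seq (cstep V)).
Hypotheses (tf : triangle_free G) (cG : construction G x y s).

Lemma stage_top : stage x y s (size s) = G.
Proof. by case: cG. Qed.

Lemma stage_sub k : k <= size s -> subgraph (stage x y s k) G.
Proof. by move=> le; rewrite -stage_top; apply: stage_subgraph; rewrite le /=. Qed.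

Lemma stage_step k st : onth s k = Some st ->
  [/\ step_vertex st \notin verts (stage x y s k),
      left_base st \in verts (stage x y s k), right_base st \in verts (stage x y s k),
      left_base st != right_base st &
      ~~ adj (stage x y s k) (left_base st) (right_base st) /\
      stage x y s k.+1 = step_graph (stage x y s k) st].
Proof.
move=> E; have [_ /(_ _ _ E) val _] := cG.
have := valid_step_ext tf val; have := stageS x y E; case: st E val => v u w L R E _ /= ES.
rewrite -ES => -[vH uH wH uw [E' _]]; split=> //; split=> //.
have [_ /subsetP sub] := stage_sub (onth_size E).
have [_ /subsetP sub'] := stage_sub (ltnW (onth_size E)).
(* Adjacent base vertices would form a triangle with the step vertex. *)
apply/negP => uwH; apply: (tf (a := v) (b := u) (c := w)).
- by apply: sub; rewrite E' -/(adj _ _ _) adj_ext !eqxx !orbT.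
- exact: sub'.
- by apply: sub; rewrite E' -/(adj _ _ _) adj_ext !eqxx !orbT.
Qed.

Lemma stage_added k st : onth s k = Some st -> added st = [set step_vertex st].
Proof.
move=> E; have [_ /(_ _ _ E) val _] := cG.
by have := valid_step_ext tf val; case: st {E val} => v u w L R [_ _ _ _ [_ ]].
Qed.

Lemma stage_hen k : k <= size s -> hen x y (stage x y s k).
Proof.
elim: k => [_|k IH lt].
  by rewrite stage0; apply: hen0; case: cG => -[[]].
have [st E] := onth_lt lt; have [vH uH wH uw [nuw ->]] := stage_step E.
exact: henS (IH (ltnW lt)) vH uH wH uw nuw.
Qed.

Lemma card_stage k : k <= size s -> #|verts (stage x y s k)| = k.+2.
Proof.
elim: k => [_|k IH lt].
  by have [xy _ _ _] := hen_base (stage_hen (leq0n _)); rewrite stage0 cards2 xy.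
have [st E] := onth_lt lt; have [vH uH wH uw [nuw ->]] := stage_step E.
by rewrite card_ext // IH // ltnW.
Qed.

Lemma rem_add_edge H u w : ~~ adj H u w -> rem_edge (add_edge H u w) u w = H.
Proof. by move=> nuw; apply: sgraph_eq; rewrite //= setU1K. Qed.

Lemma extreme_hen k st : onth s k = Some st -> tree_dec (extreme_graph x y s k st) ->
  hen (left_base st) (right_base st) (stage x y s k).
Proof.
move=> E /tree_dec_hen tH; have [_ _ _ _ [nuw _]] := stage_step E.
rewrite -(rem_add_edge nuw); apply: tH; first by rewrite /adj !inE eqxx.
rewrite rem_add_edge //.
exact: triangle_free_sub (stage_sub (ltnW (onth_size E))) tf.
Qed.

Lemma extreme_stacked :
  (forall k st, onth s k = Some st -> tree_dec (extreme_graph x y s k st)) -> stacked G.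
Proof.
move=> ext_td; rewrite -stage_top.
suff: forall k, k <= size s -> stacked (stage x y s k) by apply.
elim=> [_|k IH lt]; first by constructor 1; rewrite stage0; exists x, y; split; first by case: cG => -[[]].
have [st E] := onth_lt lt; have [vH uH wH uw [nuw ->]] := stage_step E.
exact: stackedS (IH (ltnW lt)) (extreme_hen E (ext_td _ _ E)) vH.
Qed.

(** Steps are numbered from 0, so [2 <= k] starts at the third one; before it a stage has at most
    three vertices, too few for two common neighbors. *)
Definition stacked_steps : Prop := forall k st, onth s k = Some st -> 2 <= k ->
  codeg2 (stage x y s k) (left_base st) (right_base st).

(** With at most three vertices, the only nonadjacent pair is the base pair. *)
Lemma stage_small_hen k st : k < 2 -> onth s k = Some st ->
  hen (left_base st) (right_base st) (stage x y s k).
Proof.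
move=> k2 E; have [vk uk wk uwk [nuwk _]] := stage_step E.
have ks := ltnW (onth_size E); have hk := stage_hen ks.
have [xy _ _ _] := hen_base hk.
case: (hen_cases hk) => [Ek|[v [vx vy Ek]]|/(codeg2_card (hen_simple hk))].
- by rewrite Ek in uk wk *; apply: hen_set2 (set2_pair uk wk uwk) (hen0 xy).
- by rewrite Ek in uk wk nuwk *;
    apply: hen_set2 (nadj_pair_P3 xy vx vy uk wk uwk nuwk) (hen_P3 xy vx vy).
- by rewrite card_stage // => k4; move: (leq_trans k2 k4); rewrite ltnn.
Qed.

Lemma stage_stacked k : k <= size s ->
  (forall j st, j < k -> onth s j = Some st -> 2 <= j ->
     codeg2 (stage x y s j) (left_base st) (right_base st)) ->
  stacked (stage x y s k).
Proof.
elim: k => [_ _|k IH lt sts].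
  by constructor 1; rewrite stage0; exists x, y; split; first by case: cG => -[[]].
have [st E] := onth_lt lt; have [vH uH wH uw [nuw ->]] := stage_step E.
have sk : stacked (stage x y s k).
  by apply: IH (ltnW lt) _ => j t jk; apply: sts; apply: ltnW.
apply: stackedS => //.
have [k2|/(stage_small_hen)] := leqP 2 k; last exact.
apply: quad_hen (sts _ _ (ltnSn k) E k2); apply: stacked_quad sk _.
by rewrite card_stage // ltnW.
Qed.

Lemma stage_quad k : stacked_steps -> 2 <= k <= size s -> quad (stage x y s k).
Proof.
move=> sts /andP[k2 ks]; apply: (stacked_quad (stage_stacked ks (fun j st _ => sts j st))).
by rewrite card_stage.
Qed.

Lemma stacked_steps_LCC : stacked_steps -> LCC_on G x y.
Proof.
move=> sts; exists s; split=> // k st E; apply: hen_tree_dec.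
have [k2|/(stage_small_hen)] := leqP 2 k; last exact.
by apply: quad_hen (sts _ _ E k2); apply: stage_quad; rewrite // k2 ltnW ?(onth_size E).
Qed.

(** Peel off the steps from the last one on: each peeling removes a vertex of degree 2, so
    [quad_del] carries the property down, whichever construction showed [G] to be stacked. *)
Lemma stacked_steps_of_stacked : stacked G -> stacked_steps.
Proof.
move=> stG.
have step k st : onth s k = Some st -> 2 <= k -> quad (stage x y s k.+1) ->
    quad (stage x y s k) /\ codeg2 (stage x y s k) (left_base st) (right_base st).
  move=> E k2 qS; have [vH uH wH uw [nuw ES]] := stage_step E.
  have ks := ltnW (onth_size E).
  apply: quad_del qS ES _ vH uH wH uw _; first exact: hen_simple (stage_hen ks).
  by rewrite card_stage.
(* Downward induction on the stage; [m] is the number of steps removed. *)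
have quads m : 2 <= size s - m -> m <= size s -> quad (stage x y s (size s - m)).
  elim: m => [|m IH] m2 ms.
    by rewrite subn0 stage_top in m2 *; apply: stacked_quad stG _; rewrite -stage_top card_stage.
  have lt : size s - m.+1 < size s by rewrite ltn_subrL /= (leq_ltn_trans _ ms).
  have [st E] := onth_lt lt; have ES : (size s - m.+1).+1 = size s - m by rewrite -subSn.
  by apply: (step _ _ E m2 _).1; rewrite ES; apply: IH (ltnW ms); rewrite -ES ltnW.
move=> k st E k2; apply: (step _ _ E k2 _).2; have ks := onth_size E.
have -> : k.+1 = size s - (size s - k.+1) by rewrite subKn.
by apply: quads; rewrite ?subKn // ?leq_subr // ltnW.
Qed.

End FixedConstruction.

Lemma LCC_stacked G : simple_graph G -> triangle_free G -> LCC G -> stacked G.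
Proof.
by move=> sG tf [x [y [s [cG td]]]]; apply: (extreme_stacked tf cG td).
Qed.

End Construction.

(** * Shape of 1-path constructions *)

Section Gated.
Variable V : finType.
Implicit Types (G H : sgraph V) (a b c d u v w x y z : V).

(* In [gated G v u w], [v] is the last vertex and [u], [w] are its neighbors. *)
Inductive gated : sgraph V -> V -> V -> V -> Prop :=
| gated0 x y v : x != y -> v != x -> v != y ->
    gated (ext (pairg x y) v x y) v x y
| gated1 G v u w c z : gated G v u w -> c != v -> adj G u c -> adj G w c ->
    z \notin verts G -> gated (ext G z v c) z v c
| gated2 G v u w t z : gated G v u w -> t \notin verts G ->
    z \notin verts (ext G t u w) -> gated (ext (ext G t u w) z v t) z v t.

Lemma gated_facts G v u w : gated G v u w ->
  [/\ simple_graph G, u != w, v \in verts G & forall c, adj G v c = (c == u) || (c == w)].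
Proof.
elim=> {G v u w} [x y v xy vx vy|G v u w c z _ [sG uw vG N] cv uc wc zG|G v u w t z _ [sG uw vG N] tG zG].
- have vP : v \notin verts (pairg x y) by rewrite !inE negb_or vx.
  by split; rewrite ?inE ?eqxx //; [apply: simple_ext => // | move=> c; rewrite adj_ext_new //];
    rewrite ?inE ?eqxx ?orbT //; exact: simple_pairg.
- have [_ _ cG] := simple_adj sG uc.
  split; rewrite ?inE ?eqxx //; [exact: simple_ext | by rewrite eq_sym |].
  by move=> d; rewrite adj_ext_new.
- have [uG wG] : u \in verts G /\ w \in verts G.
    have : adj G v u by rewrite N eqxx.
    have : adj G v w by rewrite N eqxx orbT.
    by move=> /(simple_adj sG)[_ _ ->] /(simple_adj sG)[_ _ ->].
  have s1 : simple_graph (ext G t u w) by exact: simple_ext.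
  have vt : v != t by apply: contraNneq tG => <-.
  have [v1 t1] : v \in verts (ext G t u w) /\ t \in verts (ext G t u w).
    by rewrite !inE eqxx vG orbT.
  split; rewrite ?inE ?eqxx //; first exact: simple_ext.
  by move=> d; rewrite adj_ext_new.
Qed.

Section OnePath.
Variables (G : sgraph V) (x y : V) (s : seq (cstep V)).
Hypotheses (tf : triangle_free G) (cG : construction G x y s).
Hypothesis sts : stacked_steps x y s.

Definition bases (l : seq (cstep V)) : seq V :=
  flatten [seq [:: left_base st; right_base st] | st <- l].

(** Step vertices not yet used as base vertices; at the end, those of the final-level steps.
    [locked] prevents [inE] from unfolding the set. *)
Definition live k : {set V} :=
  locked [set z in [seq step_vertex st | st <- take k s] | z \notin bases (take k s)].

Lemma take_onth (T : Type) (l : seq T) k t : onth l k = Some t ->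
  take k.+1 l = rcons (take k l) t.
Proof.
elim: l k => [|a l IH] [|k] //=; first by move=> [->]; rewrite take0.
by move=> /IH <-.
Qed.

Lemma bases_stage k : k <= size s -> {subset bases (take k s) <= verts (stage x y s k)}.
Proof.
elim: k => [_|k IH lt] z; first by rewrite take0.
have [st E] := onth_lt lt; have [vH uH wH uw [nuw ->]] := stage_step tf cG E.
rewrite (take_onth E) /bases map_rcons -cats1 flatten_cat mem_cat /= !inE.
case/orP => [/(IH (ltnW lt)) -> | /orP[]/eqP-> ]; by rewrite ?uH ?wH !orbT.
Qed.

Lemma live0 : live 0 = set0.
Proof. by apply/setP => z; rewrite /live -lock take0 !inE. Qed.

Lemma liveS k st : onth s k = Some st ->
  live k.+1 = step_vertex st |: (live k :\: [set left_base st; right_base st]).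
Proof.
move=> E; have [vH uH wH uw _] := stage_step tf cG E.
have ks := ltnW (onth_size E).
apply/setP => z; rewrite /live -!lock (take_onth E) !inE map_rcons mem_rcons inE.
rewrite /bases map_rcons -cats1 flatten_cat mem_cat /= !inE !negb_or -/(bases _).
have [->|zv] /= := eqVneq z (step_vertex st).
  have -> : step_vertex st \notin bases (take k s).
    by apply: contraNN vH => /(bases_stage ks).
  by rewrite /=; apply/andP; split; apply: contraNneq vH => ->.
by rewrite [RHS]andbC -!andbA.
Qed.

Lemma live_stage k : k <= size s -> {subset live k <= verts (stage x y s k)}.
Proof.
elim: k => [_|k IH lt] z; first by rewrite live0 inE.
have [st E] := onth_lt lt; have [_ _ _ _ [_ ->]] := stage_step tf cG E.
rewrite (liveS E) !inE => /orP[->//|/andP[_ /(IH (ltnW lt)) ->]]; by rewrite orbT.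
Qed.

(** Only base vertices gain neighbors, so a live vertex keeps the two it was added on. *)
Lemma live_nbrs k z : k <= size s -> z \in live k ->
  exists u w, u != w /\ forall c, adj (stage x y s k) z c = (c == u) || (c == w).
Proof.
elim: k => [_|k IH lt]; first by rewrite live0 inE.
have [st E] := onth_lt lt; have [vH uH wH uw [nuw ES]] := stage_step tf cG E.
have ks := ltnW lt; have sH := hen_simple (stage_hen tf cG ks).
rewrite (liveS E) ES !inE negb_or => /orP[/eqP->|/andP[/andP[zp zq] zl]].
  by exists (left_base st), (right_base st); split=> // c; rewrite adj_ext_new.
have [u [w [nuw' N]]] := IH ks zl; exists u, w; split=> // c.
have zv : z != step_vertex st by apply: contraNneq vH => <-; apply: live_stage ks _ zl.
have [->|cv] := eqVneq c (step_vertex st); last by rewrite adj_ext_old.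
rewrite adjC adj_ext_new // (negPf zp) (negPf zq) -N.
by apply/esym; apply: contraNF vH => /(simple_adj sH)[].
Qed.

(** An edge joins a step vertex to a base vertex of its step, and the latter is no longer live. *)
Lemma live_indep k z t : k <= size s -> z \in live k -> t \in live k ->
  ~~ adj (stage x y s k) z t.
Proof.
elim: k => [_|k IH lt]; first by rewrite live0 inE.
have [st E] := onth_lt lt; have [vH uH wH uw [nuw ES]] := stage_step tf cG E.
have ks := ltnW lt; have sH := hen_simple (stage_hen tf cG ks).
have sS : simple_graph (stage x y s k.+1) := hen_simple (stage_hen tf cG lt).
have new c : c \in live k -> c != left_base st -> c != right_base st ->
    ~~ adj (stage x y s k.+1) (step_vertex st) c.
  by move=> cl cp cq; rewrite ES adj_ext_new // negb_or cp.
rewrite (liveS E) !inE !negb_or.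
case/orP => [/eqP->|/andP[/andP[zp zq] zl]]; case/orP => [/eqP->|/andP[/andP[tp tq] tl]].
- by apply/negP => /(simple_adj sS)[]; rewrite eqxx.
- exact: new.
- by rewrite adjC; exact: new.
- have ne c : c \in live k -> c != step_vertex st.
    by move=> cl; apply: contraNneq vH => <-; apply: live_stage ks _ cl.
  by rewrite ES adj_ext_old ?ne ?IH.
Qed.

(** This invariant descends from the last stage, where at most one vertex is live. *)
Definition narrow k : Prop := #|live k| <= 2 /\
  forall z t c, z \in live k -> t \in live k ->
    adj (stage x y s k) z c = adj (stage x y s k) t c.

Lemma narrow_pred k : 2 <= k -> k < size s -> narrow k.+1 -> narrow k.
Proof.
move=> k2 lt [card2 same].
have [st E] := onth_lt lt; have [vH uH wH uw [nuw ES]] := stage_step tf cG E.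
have ks := ltnW lt; have sH := hen_simple (stage_hen tf cG ks).
set p := left_base st in uH uw nuw *; set q := right_base st in wH uw nuw *.
(* If every live vertex is a base vertex of the step, its neighbors are exactly the common neighbors
   [c], [d] of [p] and [q]. *)
have [sub|/subsetPn[t tl]] := boolP (live k \subset [set p; q]).
  have [_ [c [d [cd pc qc pd qd]]]] := sts E k2.
  split; first by apply: leq_trans (subset_leq_card sub) _; rewrite cards2; case: (_ != _).
  have N r e : r \in live k -> adj (stage x y s k) r e = (e == c) || (e == d).
    move=> rl; have [a [b [_ N]]] := live_nbrs ks rl.
    have [rc rd] : adj (stage x y s k) r c /\ adj (stage x y s k) r d.
      by have := subsetP sub _ rl; rewrite !inE => /orP[]/eqP->.
    rewrite N; rewrite !N in rc rd; move: rc rd cd.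
    by case/orP => /eqP-> /orP[]/eqP->; rewrite ?eqxx // orbC.
  by move=> z t e zl tl; rewrite !N.
rewrite !inE negb_or => /andP[tp tq].
have tl' : t \in live k.+1 by rewrite (liveS E) !inE negb_or tp tq tl orbT.
have vl' : step_vertex st \in live k.+1 by rewrite (liveS E) !inE eqxx.
have N c : adj (stage x y s k.+1) t c = (c == p) || (c == q).
  by rewrite (same _ _ c tl' vl') ES adj_ext_new.
have tv : t != step_vertex st by apply: contraNneq vH => <-; apply: live_stage ks _ tl.
have notl r : r \in verts (stage x y s k) -> (r == p) || (r == q) -> r \notin live k.
  move=> rH rpq; apply/negP => rl; case/negP: (live_indep ks tl rl).
  rewrite -N ES adj_ext_old // in rpq; by apply: contraNneq vH => <-.
have pl : p \notin live k by apply: notl; rewrite ?eqxx.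
have ql : q \notin live k by apply: notl; rewrite ?eqxx ?orbT.
have EL : live k.+1 = step_vertex st |: live k.
  rewrite (liveS E); congr (_ |: _); apply/setP => r; rewrite !inE.
  have [->|] := eqVneq r p; first by rewrite (negPf pl).
  by have [->|] := eqVneq r q; first by rewrite (negPf ql) andbF.
have vl : step_vertex st \notin live k.
  by apply: contraNN vH; apply: live_stage.
rewrite EL cardsU1 vl in card2; split; first exact: ltnW.
have {}card2 : #|live k| <= 1 by [].
by move=> z r c zl rl; rewrite (card_le1_eqP card2 z r).
Qed.

Hypothesis one : count (final_level s) s = 1.

Lemma final_levelE st : added st = [set step_vertex st] ->
  final_level s st = (step_vertex st \notin bases s).
Proof.
move=> E; rewrite /final_level E; elim: (s) => //= t l ->.
by rewrite !inE !negb_or ![_ == step_vertex st]eq_sym andbA.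
Qed.

(** Since a step adds only its step vertex, it is final-level exactly when this vertex is never a
    base vertex, and there is one such step. *)
Lemma live_top : #|live (size s)| <= 1.
Proof.
rewrite -one /live -lock take_size.
have -> : count (final_level s) s =
    size [seq z <- [seq step_vertex st | st <- s] | z \notin bases s].
  rewrite size_filter count_map.
  suff gen l : (forall k st, onth l k = Some st -> added st = [set step_vertex st]) ->
      count (final_level s) l = count (preim (@step_vertex V) (fun z => z \notin bases s)) l.
    exact/gen/(stage_added tf cG).
  elim: l => //= t l IH addE.
  by rewrite (final_levelE (addE 0 t erefl)) IH // => k; apply: (addE k.+1).
apply: leq_trans (card_size _); apply: subset_leq_card; apply/subsetP => z.
by rewrite inE mem_filter andbC.
Qed.

Lemma narrow_all k : 2 <= k <= size s -> narrow k.
Proof.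
move=> /andP[k2 ks]; suff gen m : 2 <= size s - m -> m <= size s -> narrow (size s - m).
  by rewrite -(subKn ks); apply: gen; rewrite ?subKn ?leq_subr.
elim: m => [|m IH] m2 ms.
  have top := live_top; rewrite subn0; split; first exact: leq_trans top _.
  by move=> z t c zl tl; rewrite (card_le1_eqP top z t).
have ES : (size s - m.+1).+1 = size s - m by rewrite -subSn.
have lt : size s - m.+1 < size s by rewrite ltn_subrL /= (leq_ltn_trans _ ms).
by apply: narrow_pred; rewrite // ES; apply: IH (ltnW ms); rewrite -ES ltnW.
Qed.

(** Upward induction under [narrow]: either a single vertex is live and the stage is gated at it, or
    [v] and a twin [z] are live and the stage without [z] is gated at [v]. *)
Lemma gated_stage k : 0 < k <= size s ->
  (exists v u w, gated (stage x y s k) v u w /\ live k = [set v]) \/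
  (exists H v u w z, [/\ gated H v u w, z \notin verts H,
     stage x y s k = ext H z u w & live k = [set v; z]]).
Proof.
elim: k => // k IH /andP[_ lt].
have [st E] := onth_lt lt; have [vH uH wH uw [nuw ES]] := stage_step tf cG E.
have ks := ltnW lt; have hk := stage_hen tf cG ks; have sH := hen_simple hk.
have := liveS E; move: vH uH wH uw nuw ES; rewrite /step_graph.
move: (step_vertex st) (left_base st) (right_base st) (sts E).
move=> z p q tw zH pH qH pq npq ES EL.
have [k0|k0] := posnP k.
  left; exists z, x, y; move: ES zH pH qH EL; rewrite k0 stage0 !inE negb_or => -> /andP[zx zy] px qy EL.
  have [xy _ _ _] := hen_base hk.
  have Epq : [set p; q] = [set x; y] by apply: set2_pair; rewrite ?inE.
  rewrite (ext_set2 _ _ Epq); split; first exact: gated0.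
  by rewrite EL live0; apply/setP => r; rewrite !inE andbF orbF.
have k2 : 1 < k.+1 <= size s by rewrite ltnS k0.
have [card2 same] := narrow_all k2.
have liveH r : r \in live k -> r != z by move=> rl; apply: contraNneq zH => <-; apply: live_stage ks _ rl.
have Nz c : adj (stage x y s k.+1) z c = (c == p) || (c == q) by rewrite ES adj_ext_new.
have zl : z \in live k.+1 by rewrite EL !inE eqxx.
(* A live vertex that survives the step is a twin of the new vertex. *)
have surv r : r \in live k -> r != p -> r != q ->
    forall c, c != z -> adj (stage x y s k) r c = (c == p) || (c == q).
  move=> rl rp rq c cz; have rl' : r \in live k.+1 by rewrite EL !inE negb_or rp rq rl orbT.
  by rewrite -Nz -(same _ _ c rl' zl) ES adj_ext_old // liveH.
case: (IH _) => [|[v [u [w [gG L]]]]|[H [v [u [w [t [gH tH EH L]]]]]]]; first by rewrite k0.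
- have vl : v \in live k by rewrite L set11.
  have [_ nuw vG N] := gated_facts gG.
  (* The live vertex [v] is used. Its only neighbors [u], [w] must then be the common neighbors of
     the two base vertices, as in [gated1]. *)
  have [vpq|] := boolP (v \in [set p; q]).
    left; wlog vp : p q tw pH qH pq npq ES EL vpq {Nz surv} / v = p => [wl|].
      have := vpq; rewrite !inE => /orP[/eqP vp|/eqP vq]; first exact: (wl p q).
      apply: (wl q p) => //; [by move=> /tw/codeg2C | by rewrite eq_sym | by rewrite adjC
        | by rewrite extC | by rewrite (setUC [set q]) | by rewrite setUC].
    exists z, p, q; rewrite ES; split; last first.
      by rewrite EL L vp; apply/setP => r; rewrite !inE; case: (r == p); rewrite ?andbF ?orbF.
    rewrite vp in gG N; have [k2'|k1] := leqP 2 k.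
      have [_ [c [d [cd pc qc pd qd]]]] := tw k2'.
      have qp : q != p by rewrite eq_sym.
      rewrite !N in pc pd.
      case/orP: pc pd qc qd cd => /eqP-> /orP[]/eqP->; rewrite ?eqxx // => qc qd _;
        by apply: (gated1 gG qp) zH; rewrite adjC.
    (* At the second step, [q] would be a fourth vertex of a stage that has three. *)
    exfalso; move: (card_stage tf cG ks) => c3.
    have {}k1 : k = 1 by apply/eqP; rewrite eqn_leq k0 andbT -ltnS.
    have [_ pu] : p \in verts (stage x y s k) /\ u \in verts (stage x y s k).
      by have := N u; rewrite eqxx => /(simple_adj sH)[].
    have wk : w \in verts (stage x y s k).
      by have := N w; rewrite eqxx orbT => /(simple_adj sH)[].
    have pu' : p != u by have := N u; rewrite eqxx => /(simple_adj sH)[].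
    have pw' : p != w by have := N w; rewrite eqxx orbT => /(simple_adj sH)[].
    have U : uniq [:: q; p; u; w].
      rewrite N negb_or in npq; case/andP: npq => qu qw.
      by rewrite /= !inE !negb_or eq_sym pq qu qw pu' pw' nuw.
    have: #|[:: q; p; u; w]| <= #|verts (stage x y s k)|.
      by apply: subset_leq_card; apply/subsetP => r; rewrite !inE => /or4P[]/eqP->.
    by rewrite (card_uniqP U) c3 k1.
  rewrite !inE negb_or => /andP[vp vq]; right.
  have pz : p != z by apply: contraNneq zH => <-.
  have qz : q != z by apply: contraNneq zH => <-.
  exists (stage x y s k), v, u, w, z; split=> //.
    rewrite ES; apply: ext_set2; apply: set2_pair; rewrite // !inE -N (surv v) // ?eqxx ?orbT //.
  rewrite EL L; apply/setP => r; rewrite !inE orbC.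
  by have [->|] := eqVneq r v; rewrite ?andbF ?orbF ?negb_or ?vp ?vq.
- left; have [_ nuw vG N] := gated_facts gH.
  have vt : v != t by apply: contraNneq tH => <-.
  have [vl tl] : v \in live k /\ t \in live k by rewrite L !inE !eqxx orbT.
  have pz : p != z by apply: contraNneq zH => <-.
  have qz : q != z by apply: contraNneq zH => <-.
  have used a b : a \in live k -> b \in live k -> b \in [set p; q] -> a \in [set p; q].
    move=> al bl; rewrite !inE; apply: contraLR => /norP[ap aq]; apply/negP => bpq.
    case/negP: (live_indep ks al bl); rewrite (surv a) //; exact: liveH.
  have tpq : t \in [set p; q].
    apply: contraLR card2 => tpq; have vpq : v \notin [set p; q] by apply: contraNN tpq; apply: used.
    rewrite -ltnNge EL L.
    have -> : z |: [set v; t] :\: [set p; q] = [set r in [:: z; v; t]].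
      rewrite !inE in vpq tpq; apply/setP => r; rewrite !inE.
      have [->|_] := eqVneq r v; first by rewrite vpq ?eqxx ?orbT.
      by have [->|_] := eqVneq r t; rewrite ?tpq /= ?eqxx ?orbT ?andbF.
    rewrite cardsE (card_uniqP _) //= !inE negb_or vt ![z == _]eq_sym !liveH //.
  have vpq : v \in [set p; q] by apply: used tl tpq.
  exists z, v, t; rewrite ES -(ext_set2 _ _ (set2_pair vpq tpq vt)); split.
    by rewrite EH; apply: gated2 gH tH _; rewrite -EH.
  rewrite EL L (set2_pair vpq tpq vt); apply/setP => r; rewrite !inE.
  by rewrite andNb orbF.
Qed.

(** At the end at most one vertex is live, which rules out a pair of twins. *)
Lemma gated_top : 0 < size s -> exists v u w, gated G v u w.
Proof.
move=> s0; case: (gated_stage (k := size s)); rewrite ?s0 ?leqnn //.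
  by case=> v [u [w [gG _]]]; exists v, u, w; rewrite -(stage_top cG).
case=> H [v [u [w [z [gH zH _ L]]]]]; have := live_top.
rewrite L cards2; suff -> : v != z by [].
by apply: contraNneq zH => <-; case: (gated_facts gH).
Qed.

End OnePath.
End Gated.

(** * The planarity obstruction modulo 2 *)

Section Parity.
Variable V : finType.
Implicit Types (G H : sgraph V) (a b c d u v w x y z : V).

(* [up a e] stands for the parity of the crossings of the arc [e] with the upward ray
   from [a], and [h a c] tells whether [a] is to the right of [c].  The second clause
   holds when the arcs of the disjoint edges [a b] and [c d] do not meet. *)
Definition parity_system G (up : V -> {set V} -> bool) (h : V -> V -> bool) : Prop :=
  (forall a b, a \in verts G -> b \in verts G -> a != b -> h b a = ~~ h a b) /\
  forall a b c d, uniq [:: a; b; c; d] -> adj G a b -> adj G c d ->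
    up a [set c; d] (+) up b [set c; d] (+) up c [set a; b] (+) up d [set a; b] =
    h a c (+) h b c (+) h a d (+) h b d.

Definition has_parity G : Prop := exists up h, parity_system G up h.

Lemma has_parity_sub G H : subgraph H G -> has_parity G -> has_parity H.
Proof.
move=> [/subsetP sv /subsetP se] [up [h [anti rel]]]; exists up, h; split=> [a b aH bH|a b c d U ab cd].
  by apply: anti; apply: sv.
by apply: rel => //; apply: se.
Qed.

(** The tactic [ring] handles booleans through [xorb]. *)
Let addb_xorb (p q : bool) : p (+) q = xorb p q.
Proof. by case: p; case: q. Qed.

Let xorb_eq (p q : bool) : p = q <-> xorb p q = false.
Proof. by case: p; case: q. Qed.

(* Each [U k l (a i)] occurs in exactly two of the 18 relations, and so cancels in their
   sum; what remains is the parity of the number of negated values of [h], which is odd. *)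
Lemma K33_parity (h : V -> V -> bool) (U : nat -> nat -> V -> bool) (a b : nat -> V) :
  (forall j l, j < l < 3 -> h (b l) (b j) = ~~ h (b j) (b l)) ->
  (forall i j, i < 3 -> j < 3 -> h (b j) (a i) = ~~ h (a i) (b j)) ->
  (forall i k j l, i < k < 3 -> j < 3 -> l < 3 -> j != l ->
    U k l (a i) (+) U k l (b j) (+) U i j (a k) (+) U i j (b l) =
    h (a i) (a k) (+) h (b j) (a k) (+) h (a i) (b l) (+) h (b j) (b l)) -> False.
Proof.
move=> hb hab rel.
pose X i k j l :=
  xorb (xorb (xorb (xorb (U k l (a i)) (U k l (b j))) (U i j (a k))) (U i j (b l)))
   (xorb (xorb (xorb (h (a i) (a k)) (h (b j) (a k))) (h (a i) (b l))) (h (b j) (b l))).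
have X0 i k j l : i < k < 3 -> j < 3 -> l < 3 -> j != l -> X i k j l = false.
  by move=> *; rewrite /X -!addb_xorb rel // addbb.
pose S i k := xorb (xorb (xorb (X i k 0 1) (X i k 0 2)) (xorb (X i k 1 0) (X i k 1 2)))
  (xorb (X i k 2 0) (X i k 2 1)).
have S0 i k : i < k < 3 -> S i k = false by move=> ik; rewrite /S !X0.
have neg (c : bool) : ~~ c = xorb true c by case: c.
suff: xorb (xorb (S 0 1) (S 0 2)) (S 1 2) = true by rewrite !S0.
rewrite /S /X !hab // !(hb 0 1) // !(hb 0 2) // !(hb 1 2) // !neg.
ring.
Qed.

Fixpoint walk_up (up : V -> {set V} -> bool) v m (r : seq V) : bool :=
  if r is n :: r' then up v [set m; n] (+) walk_up up v n r' else false.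

(** Summing the relations between [s t] and the edges of the walk cancels the terms of inner
    vertices, so the walk behaves like a single arc. *)
Lemma parity_walk G up h s t m r : simple_graph G -> parity_system G up h ->
  adj G s t -> path (adj G) m r -> s \notin m :: r -> t \notin m :: r ->
  walk_up up s m r (+) walk_up up t m r (+) up m [set s; t] (+) up (last m r) [set s; t] =
  h s m (+) h t m (+) h s (last m r) (+) h t (last m r).
Proof.
move=> sG [anti rel] st; elim: r m => [|n r IH] m.
  by move=> _ _ _ /=; case: (up m _); case: (h s m); case: (h t m).
move=> pmr smr tmr; have /andP[mn pr] : adj G m n && path (adj G) n r := pmr.
have /norP[sm sr] : ~~ ((s == m) || (s \in n :: r)) := smr.
have /norP[tm tr] : ~~ ((t == m) || (t \in n :: r)) := tmr.
have := IH n pr sr tr.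
have U : uniq [:: s; t; m; n].
  have [nst _ _] := simple_adj sG st; have [nmn _ _] := simple_adj sG mn.
  move: sr tr; rewrite !inE !negb_or => /andP[sn _] /andP[tn _].
  by rewrite /= !inE !negb_or nst sm sn tm tn nmn.
have := rel _ _ _ _ U st mn; rewrite /=.
move/xorb_eq => E1 /xorb_eq E2; apply/xorb_eq.
rewrite -[RHS]/(xorb false false) -(congr2 xorb E1 E2) !addb_xorb.
ring.
Qed.

(** The sides of the [K_{3,3}] are [u], [w], [m] and [x], [x'], [z]; the walk [r] stands for the
    edge [m z]. *)
Lemma no_K33 G u w m x x' z r : simple_graph G -> has_parity G ->
  uniq [:: u; w; m; x; x'; z] ->
  (forall a, a \in [:: u; w] -> [/\ adj G a x, adj G a x' & adj G a z]) ->
  adj G m x -> adj G m x' -> path (adj G) m r -> last m r = z ->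
  all (fun c => c \notin [:: u; w; x; x']) r -> False.
Proof.
move=> sG [up [h P]] U uw mx mx' pr lr ar; have [anti rel] := P.
have [[ux ux' uz] [wx wx' wz]] : [/\ adj G u x, adj G u x' & adj G u z] /\
   [/\ adj G w x, adj G w x' & adj G w z] by split; apply: uw; rewrite !inE eqxx ?orbT.
pose a i := nth u [:: u; w; m] i; pose b j := nth x [:: x; x'; z] j.
pose E i j c := if (i == 2) && (j == 2) then walk_up up c m r else up c [set a i; b j].
have aG i : i < 3 -> a i \in verts G.
  by case: i => [|[|[|]]] // _; rewrite /a /=;
    [case: (simple_adj sG ux) | case: (simple_adj sG wx) | case: (simple_adj sG mx)].
have bG j : j < 3 -> b j \in verts G.
  by case: j => [|[|[|]]] // _; rewrite /b /=;
    [case: (simple_adj sG ux) | case: (simple_adj sG ux') | case: (simple_adj sG uz)].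
pose c := nth u [:: u; w; m; x; x'; z].
have cU i j : i < 6 -> j < 6 -> (c i == c j) = (i == j) by move=> i6 j6; apply: nth_uniq.
have ca i : i < 3 -> a i = c i by case: i => [|[|[|]]].
have cb j : j < 3 -> b j = c (j + 3) by case: j => [|[|[|]]].
have lt6 i : i < 3 -> i < 6 by move=> ?; apply: ltn_trans (_ : 3 < 6).
have lt6' i : i < 3 -> i + 3 < 6 by move=> ?; rewrite -[6]/(3 + 3) ltn_add2r.
have bb j l : j < 3 -> l < 3 -> (b j == b l) = (j == l).
  by move=> j3 l3; rewrite !cb // cU ?lt6' // eqn_add2r.
have aa j l : j < 3 -> l < 3 -> (a j == a l) = (j == l).
  by move=> j3 l3; rewrite !ca // cU ?lt6.
have ab i j : i < 3 -> j < 3 -> a i != b j.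
  move=> i3 j3; rewrite ca // cb // cU; [|exact: lt6|exact: lt6'].
  apply: contraTneq i3 => ->.
  by rewrite -leqNgt leq_addl.
have adj_ab i j : i < 3 -> j < 3 -> ~~ ((i == 2) && (j == 2)) -> adj G (a i) (b j).
  by case: i => [|[|[|]]] //; case: j => [|[|[|]]].
apply: (@K33_parity h E a b) => [j l /andP[jl l3]|i j i3 j3|i k j l /andP[ik k3] j3 l3 jl].
- have j3 := ltn_trans jl l3; apply: anti; rewrite ?bG // bb //; by rewrite neq_ltn jl.
- by apply: anti; rewrite ?bG ?aG ?ab.
have i3 := ltn_trans ik k3; have nik : i != k by rewrite neq_ltn ik.
have i2 : i < 2 by apply: leq_trans ik _; rewrite -ltnS.
have ni2 : (i == 2) = false by apply/negbTE; rewrite neq_ltn i2.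
have aij : adj G (a i) (b j) by apply: adj_ab; rewrite ?ni2.
(* As [i < k], only the second edge can be the one replaced by the walk, namely when [k = l = 2]. *)
rewrite /E ni2 /=; have [/andP[/eqP k2 /eqP l2]|nkl] := ifPn ((k == 2) && (l == 2)).
  have j2 : j < 2 by move: j3 jl; rewrite l2 ltnS leq_eqVlt => /orP[->|].
  have -> : a k = m by rewrite k2.
  have -> : b l = last m r by rewrite l2 lr.
  have notin c' : c' \in [:: u; w; x; x'] -> c' != m -> c' \notin m :: r.
    move=> cin cm; rewrite inE negb_or cm; apply/negP => /(allP ar).
    by rewrite cin.
  apply: parity_walk sG P aij pr _ _; apply: notin.
  - by case: (i) i2 => [|[|]] // _; rewrite /a /= !inE eqxx ?orbT.
  - by rewrite (_ : m = a 2) // aa ?ni2.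
  - by case: (j) j2 => [|[|]] // _; rewrite /b /= !inE eqxx ?orbT.
  - by rewrite (_ : m = a 2) // eq_sym ab.
apply: rel => //; last exact: adj_ab.
by rewrite /= !inE !negb_or !ab // aa // bb // nik jl eq_sym ab.
Qed.

Definition far G u w c : bool :=
  [&& c \in verts G, c != u, c != w & ~~ (adj G u c && adj G w c)].

(** Induction on the construction from [u], [w]. A new far vertex joined to a far one extends a
    walk. Otherwise its two neighbors are nonadjacent and not [u] and [w], of which it would be a
    common neighbor; so both are common neighbors of [u] and [w], and the walk is trivial. *)
Lemma hen_far_walk G u w q : hen u w G -> far G u w q ->
  exists m x x' r, [/\ x != x', adj G u x && adj G w x, adj G u x' && adj G w x',
    adj G m x && adj G m x' & [/\ path (adj G) m r, last m r = q & all (far G u w) (m :: r)]].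
Proof.
move=> hG; elim: hG q => [uw q|{}G v a b hG IH vG aG bG ab nab q].
  by rewrite /far !inE; case: (q == u); case: (q == w).
have sG := hen_simple hG; have [uw uG wG nuw] := hen_base hG.
have ne t : t \in verts G -> t != v by apply: contraTneq => ->.
have farG c : c \in verts G -> far (ext G v a b) u w c = far G u w c.
  by move=> cG; rewrite /far !adj_ext_old ?ne // inE cG orbT.
have lift q' : far G u w q' ->
  exists m x x' r, [/\ x != x', adj (ext G v a b) u x && adj (ext G v a b) w x,
      adj (ext G v a b) u x' && adj (ext G v a b) w x',
      adj (ext G v a b) m x && adj (ext G v a b) m x' &
      [/\ path (adj (ext G v a b)) m r, last m r = q' & all (far (ext G v a b) u w) (m :: r)]].
  move=> /IH[m [x [x' [r [xx' /andP[ux wx] /andP[ux' wx'] /andP[mx mx'] [pr lr fr]]]]]].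
  exists m, x, x', r; rewrite !adj_extW //; split=> //; split=> //.
    by apply: sub_path pr => c d; apply: adj_extW.
  by apply/allP => c /(allP fr) fc; rewrite farG //; case/andP: fc.
have [->|qv] := eqVneq q v; last first.
  move=> fq; apply: lift; rewrite -farG //.
  by case/andP: fq; rewrite !inE (negPf qv).
move=> fv.
have via c : far G u w c -> (c == a) || (c == b) ->
  exists m x x' r, [/\ x != x', adj (ext G v a b) u x && adj (ext G v a b) w x,
      adj (ext G v a b) u x' && adj (ext G v a b) w x',
      adj (ext G v a b) m x && adj (ext G v a b) m x' &
      [/\ path (adj (ext G v a b)) m r, last m r = v & all (far (ext G v a b) u w) (m :: r)]].
  move=> fc cab; have [m [x [x' [r [? ? ? ? [pr lr fr]]]]]] := lift _ fc.
  exists m, x, x', (rcons r v); split=> //; split.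
  - by rewrite rcons_path pr lr adjC adj_ext_new.
  - by rewrite last_rcons.
  - by rewrite -rcons_cons all_rcons fv.
have [/via|na] := boolP (far G u w a); first by rewrite eqxx; apply.
have [/via|nb] := boolP (far G u w b); first by rewrite eqxx orbT; apply.
have new c : c \in verts G -> adj (ext G v a b) c v = (c == a) || (c == b).
  by move=> cG; rewrite adjC adj_ext_new.
have near c : c \in verts G -> ~~ far G u w c -> (c \in [:: u; w]) || adj G u c && adj G w c.
  by rewrite /far !inE => ->; case: (c == u); case: (c == w); rewrite //= negbK.
have := near _ aG na; have := near _ bG nb; rewrite !inE.
have nuwv : ~~ (((u == a) || (u == b)) && ((w == a) || (w == b))).
  by case/and4P: fv => _ _ _; rewrite !new.
case/orP => [bu|/andP[bu bw]]; case/orP => [au|/andP[au aw]].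
- exfalso; move: nuwv uw ab; case/orP: bu => /eqP ->; case/orP: au => /eqP ->; rewrite ?eqxx ?orbT //.
- exfalso; move: nab; by case/orP: bu => /eqP ->; rewrite adjC ?au ?aw.
- exfalso; move: nab; by case/orP: au => /eqP ->; rewrite ?bu ?bw.
exists v, a, b, [::]; rewrite !adj_ext_new // !eqxx orbT /= fv !adj_extW //.
Qed.

(** In a 4-cycle every nonadjacent pair qualifies. Later, only pairs containing the newest vertex
    [z] need the [K_{3,3}]; for other pairs [z] is dropped and the induction hypothesis applies. *)
Lemma quad_parity G v p q : quad G -> v \notin verts G -> p \in verts G ->
  q \in verts G -> p != q -> ~~ adj G p q -> has_parity (ext G v p q) -> codeg2 G p q.
Proof.
move=> qG; elim: qG p q => [x y a b U|{}G z u w qG IH zG t] p q.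
  have /= := U; rewrite !inE !negb_or !andbT => /and3P[/and3P[xy xa xb] /andP[ya yb] ab].
  have xyC : codeg2 (C4 x y a b) x y.
    by split=> //; exists a, b; rewrite !adj_C4 !inE !eqxx !orbT.
  have abC : codeg2 (C4 x y a b) a b.
    by split=> //; exists x, y; rewrite !adj_C4 !inE !eqxx !orbT.
  move=> _.
  move=> pG qG pq npq _.
  have: (p \in [:: x; y]) && (q \in [:: x; y]) || (p \in [:: a; b]) && (q \in [:: a; b]).
    move: npq; rewrite adj_C4; move: pG qG; rewrite !inE.
    by do 8 case: (_ == _).
  rewrite !inE -![(_ == _) || (_ == _)]in_set2.
  by case/orP => /andP[pin qin]; [apply: codeg2_set2 xyC | apply: codeg2_set2 abC]; apply: set2_pair.
have sG := quad_simple qG; have [uw uG wG] := simple_codeg2_verts sG t.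
have hG := quad_hen qG t.
have ne c : c \in verts G -> c != z by apply: contraTneq => ->.
have new c : v \notin verts (ext G z u w) -> c \in verts (ext G z u w) -> c != z ->
    ~~ adj (ext G z u w) z c -> has_parity (ext (ext G z u w) v z c) -> codeg2 (ext G z u w) z c.
  move=> vG cG cz; have {}cG : c \in verts G by move: cG; rewrite !inE (negPf cz).
  rewrite adj_ext_new // negb_or => /andP[cu cw] par; split; first by rewrite eq_sym.
  (* If [c] is adjacent to the neighbors [u], [w] of [z], these are the wanted common neighbors. *)
  have [/andP[uc wc]|nfar] := boolP (adj G u c && adj G w c).
    exists u, w; rewrite uw !adj_ext_new // !eqxx orbT !adj_ext_old ?ne //.
    by rewrite !(adjC G c).
  have fc : far G u w c by rewrite /far cG cu cw.
  have [m [x [x' [r [xx' /andP[ux wx] /andP[ux' wx'] /andP[mx mx'] [pr lr fr]]]]]] := hen_far_walk hG fc.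
  exfalso; set K := ext (ext G z u w) v z c in par.
  have s1 : simple_graph (ext G z u w) by apply: simple_ext.
  have [z1 c1] : z \in verts (ext G z u w) /\ c \in verts (ext G z u w) by rewrite !inE eqxx cG orbT.
  have sK : simple_graph K by apply: simple_ext.
  have up a b : adj G a b -> adj K a b by move=> ab; do 2 apply: adj_extW.
  have vGG : v \notin verts G by apply: contraNN vG => vG; rewrite inE vG orbT.
  have vz : v != z by apply: contraNneq vG => ->.
  have farX d e : far G u w d -> adj G u e -> adj G w e -> d != e.
    by move=> /and4P[_ _ _] + ue we; apply: contraNneq => ->; rewrite ue.
  have fm : far G u w m by case/andP: fr.
  have [mG mu mw _] := and4P fm.
  have [nux _ xG] := simple_adj sG ux; have [nwx _ _] := simple_adj sG wx.
  have [nux' _ xG'] := simple_adj sG ux'; have [nwx' _ _] := simple_adj sG wx'.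
  (* The walk from [m] to [c], continued through [v], reaches [z]. *)
  apply: (@no_K33 K u w m x x' z (r ++ [:: v; z])) => //.
  - rewrite /= !inE !negb_or uw nux nux' nwx nwx' xx' !ne // !(farX m) //.
    by rewrite ![_ == m]eq_sym mu mw.
  - move=> e; rewrite !inE => /orP[]/eqP->; split; try exact: up; rewrite adjC;
      by apply: adj_extW; rewrite adj_ext_new // eqxx ?orbT.
  - exact: up.
  - exact: up.
  - rewrite cat_path lr /= andbT; apply/and3P; split.
    + by apply: sub_path pr.
    + by rewrite adjC adj_ext_new // eqxx orbT.
    + by rewrite adj_ext_new // eqxx.
  - by rewrite last_cat.
  - have old e d : e \notin verts G -> d \in verts G -> e != d by move=> eG; apply: contraTneq => <-.
    rewrite all_cat /= !inE !negb_or !old //= andbT.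
    apply/allP => d dr; have fd : far G u w d by apply: (allP fr); rewrite inE dr orbT.
    have [_ du dw _] := and4P fd.
    by rewrite !inE !negb_or du dw !(farX d).
move=> vG pG qG' pq npq par.
have [pz|pz] := eqVneq p z.
  by rewrite pz in pq npq par *; apply: new; rewrite // eq_sym.
have [qz|qz] := eqVneq q z.
  rewrite qz in pq npq par *; rewrite extC in par; apply: codeg2C; apply: new => //.
  by rewrite adjC.
apply: codeg2W; move: pG qG' vG; rewrite !inE (negPf pz) (negPf qz) negb_or /= => pG qG' /andP[vz vG].
apply: IH => //; first by rewrite adj_ext_old in npq.
apply: has_parity_sub par; split; apply/subsetP => e; rewrite !inE.
  by case/orP => ->; rewrite ?orbT.
by case/or3P => ->; rewrite ?orbT.
Qed.

Lemma parity_stacked_steps G x y (s : seq (cstep V)) : triangle_free G ->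
  construction G x y s -> has_parity G -> stacked_steps x y s.
Proof.
move=> tf cG par; suff gen m j t : m <= size s -> j < m -> onth s j = Some t -> 2 <= j ->
    codeg2 (stage x y s j) (left_base t) (right_base t).
  by move=> k st E; apply: gen (onth_size E) (ltnSn k) E.
elim: m j t => // m IH j t lt; rewrite ltnS leq_eqVlt => /orP[/eqP->|]; last exact/IH/ltnW.
move=> E m2; have [vH uH wH uw [nuw ES]] := stage_step tf cG E.
have qH : quad (stage x y s m).
  apply: stacked_quad; last by rewrite (card_stage tf cG) // ltnW.
  by apply: (stage_stacked tf cG (ltnW lt)) => i t' im; apply: IH (ltnW lt) im.
apply: quad_parity qH vH uH wH uw nuw _.
by apply: has_parity_sub par; rewrite -/(step_graph _ _) -ES; apply: (stage_sub cG).
Qed.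

End Parity.

From mathcomp Require Import all_classical all_reals all_analysis.
From mathcomp Require Import ring lra.
Import Order.TTheory GRing.Theory Num.Theory.
Import numFieldNormedType.Exports.
Local Open Scope classical_set_scope.
Local Open Scope ring_scope.

(** * Crossing parities of two disjoint arcs *)

Section Crossings.
Variable R : realType.
Implicit Types (z w a b : R * R) (P Q : R -> R * R).

(* The right half-plane, with the boundary split so that [z] and [- z] lie on
   different sides for every nonzero [z]. *)
Definition right_side z : bool := (0 < z.1) || (z.1 == 0) && (0 < z.2).

(* Parity of the crossings of the upper vertical half-axis between [z] and [w],
   for [z] and [w] close to each other. *)
Definition crosses z w : bool := (right_side z (+) right_side w) && (0 < z.2).

(** In such a region, crossing the upper half-axis is either impossible or the same as changing
    side; small boxes away from the origin are of this kind. *)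
Definition tame (A : set (R * R)) : Prop :=
  [\/ forall z w, A z -> A w -> right_side z = right_side w,
      forall z, A z -> 0 < z.2 | forall z, A z -> z.2 < 0].

Lemma right_sideN z : z != 0 -> right_side (- z) = ~~ right_side z.
Proof.
case: z => x y; rewrite /right_side /= -[0]/(0, 0) xpair_eqE negb_and !oppr_gt0 oppr_eq0.
by case: (ltgtP x 0) => //= _; case: (ltgtP y 0).
Qed.

Lemma tame_cycle A z1 z2 z3 z4 : tame A -> A z1 -> A z2 -> A z3 -> A z4 ->
  crosses z1 z2 (+) crosses z3 z4 = crosses z1 z3 (+) crosses z2 z4.
Proof.
rewrite /crosses => -[H|H|H] A1 A2 A3 A4.
- by rewrite !(H z1 z2) // !(H z3 z4) // !(H z2 z4) // !addbb.
- by rewrite !H // !andbT; do 4 case: (right_side _).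
- by rewrite ![0 < _]ltNge !ltW ?H // !andbF.
Qed.

(** The antipodal map exchanges crossings of the upper and the lower half-axis, and both together
    account for the changes of side. *)
Lemma tame_crossesN A z w : tame A -> A z -> A w -> z != 0 -> w != 0 ->
  crosses (- z) (- w) = crosses z w (+) right_side z (+) right_side w.
Proof.
rewrite /crosses => tA Az Aw z0 w0; rewrite !right_sideN //= oppr_gt0.
case: tA => [H|H|H].
- by rewrite (H z w) // !addbb.
- by rewrite H // ltNge ltW ?H //; do 2 case: (right_side _).
- by rewrite H // [0 < _]ltNge ltW ?H //; do 2 case: (right_side _).
Qed.

Lemma tame_ball z0 : z0 != 0 -> exists2 e : R, 0 < e &
  tame [set z | `|z.1 - z0.1| < e /\ `|z.2 - z0.2| < e].
Proof.
case: z0 => x0 y0 /=; rewrite -[0]/(0, 0) xpair_eqE negb_and.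
have [x0p|x0n|-> /= y0n] := ltgtP x0 0.
- move=> _; exists (- x0); first by rewrite oppr_gt0.
  constructor 1 => -[x y] [x' y'] /= [+ _] [+ _]; rewrite !ltr_norml /right_side /=.
  move=> /andP[_ h] /andP[_ h'].
  have hx : x < 0 by lra.
  have hx' : x' < 0 by lra.
  by rewrite !(lt_gtF hx, lt_gtF hx', lt_eqF hx, lt_eqF hx').
- move=> _; exists x0 => //.
  constructor 1 => -[x y] [x' y'] /= [+ _] [+ _]; rewrite !ltr_norml /right_side /=.
  move=> /andP[h _] /andP[h' _].
  have -> : 0 < x by lra.
  by have -> : 0 < x' by lra.
have [y0p|y0p|E] := ltgtP y0 0; last by rewrite E eqxx in y0n.
- exists (- y0); first by rewrite oppr_gt0.
  by constructor 3 => -[x y] /= [_]; rewrite ltr_norml => /andP[_ h]; lra.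
- exists y0 => //.
  by constructor 2 => -[x y] /= [_]; rewrite ltr_norml => /andP[h _]; lra.
Qed.

Lemma within_eps P : {within `[0, 1]%classic, continuous P} -> forall s e : R,
  s \in `[0, 1] -> 0 < e -> exists2 d : R, 0 < d & forall t : R, t \in `[0, 1] -> `|t - s| < d ->
    `|(P t).1 - (P s).1| < e /\ `|(P t).2 - (P s).2| < e.
Proof.
move=> /subspace_continuousP cP s e s01 e0.
have /cP H : `[0, 1]%classic s by [].
have /H : nbhs (P s) (ball (P s) e) by apply: nbhsx_ballx.
rewrite /= nbhs_simpl /within /= => /nbhs_ballP[d d0 B]; exists d => // t t01 ts.
have := B t; rewrite /ball /= distrC => /(_ ts t01).
by rewrite /ball /= /prod_ball /ball /= ![`|(P t).1 - _|]distrC ![`|(P t).2 - _|]distrC.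
Qed.

(** Compactness of the unit square: near each [(s, t)] the difference [Q t - P s] stays in a small
    box around a nonzero point. *)
Lemma tame_cells P Q :
  {within `[0, 1]%classic, continuous P} -> {within `[0, 1]%classic, continuous Q} ->
  (forall s t : R, s \in `[0, 1] -> t \in `[0, 1] -> P s <> Q t) ->
  \forall n \near \oo, forall s t : R, s \in `[0, 1] -> t \in `[0, 1] ->
    tame [set z | exists s' t' : R, [/\ s' \in `[0, 1], t' \in `[0, 1],
      `|s' - s| <= n.+1%:R^-1, `|t' - t| <= n.+1%:R^-1 & z = Q t' - P s']].
Proof.
move=> cP cQ PQ.
have cpt : compact (`[0, 1]%classic `*` `[0, 1]%classic : set (R * R)).
  by apply: compact_setX; apply: segment_compact.
have := (compact_near_coveringP _).1 cpt nat \oo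
  (fun n st => tame [set z | exists s' t' : R, [/\ s' \in `[0, 1], t' \in `[0, 1],
      `|s' - st.1| <= n.+1%:R^-1, `|t' - st.2| <= n.+1%:R^-1 & z = Q t' - P s']]) _.
move=> /(_ _)[|N _ H]; last by exists N => // n /H K s t s01 t01; apply: (K (s, t)).
move=> [s t] /= [s01 t01].
have ne : Q t - P s != 0.
  by rewrite subr_eq0; apply/eqP => /esym; apply: PQ.
have [e e0 te] := tame_ball ne.
have e20 : 0 < e / 2 by rewrite divr_gt0.
have [d1 d10 D1] := within_eps cP s01 e20.
have [d2 d20 D2] := within_eps cQ t01 e20.
pose d := Num.min d1 d2.
have d0 : 0 < d by rewrite lt_min d10.
(* Half of [d] is for the displacement of the center, half for the mesh. *)
have dh : 0 < d / 2 by rewrite divr_gt0.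
exists (ball (s, t) (d / 2), [set n | n.+1%:R^-1 < d / 2]).
  split; first exact: nbhsx_ballx.
  exact: (near_infty_natSinv_lt (PosNum dh)).
move=> [[s1 t1] n] /= [[/= bs bt] nd].
have sub : [set z | exists s' t' : R, [/\ s' \in `[0, 1], t' \in `[0, 1],
      `|s' - s1| <= n.+1%:R^-1, `|t' - t1| <= n.+1%:R^-1 & z = Q t' - P s']] `<=`
    [set z | `|z.1 - (Q t - P s).1| < e /\ `|z.2 - (Q t - P s).2| < e].
  move=> z [s' [t' [s'01 t'01 ss' tt' ->]]] /=.
  have far (x y y' : R) : ball x (d / 2) y -> `|y' - y| <= n.+1%:R^-1 -> `|y' - x| < d.
    rewrite /ball /= => xy yy'; rewrite (_ : y' - x = (y' - y) - (x - y)); last by lra.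
    apply: le_lt_trans (ler_normB _ _) _; rewrite (splitr d) ltrD //.
    exact: le_lt_trans yy' nd.
  have [|p1 p2] := D1 s' s'01; first by apply: lt_le_trans (far _ _ _ bs ss') _; rewrite ge_min lexx.
  have [|q1 q2] := D2 t' t'01; first by apply: lt_le_trans (far _ _ _ bt tt') _; rewrite ge_min lexx orbT.
  move: p1 p2 q1 q2; rewrite !ltr_norml => /andP[? ?] /andP[? ?] /andP[? ?] /andP[? ?].
  by split; apply/andP; split; lra.
by case: te => H; [constructor 1 => ? ? /sub ? /sub ?|constructor 2 => ? /sub ?|constructor 3 => ? /sub ?]; apply: H.
Qed.

(** Crossings modulo 2 of the upward ray from [a] by the arc [P], sampled at [n + 2] points. *)
Definition crossings n a P : bool := \big[addb/false]_(0 <= i < n.+1)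
  crosses (P (i%:R / n.+1%:R) - a) (P (i.+1%:R / n.+1%:R) - a).

Lemma addb_telescope (f : nat -> bool) n :
  \big[addb/false]_(0 <= i < n) (f i (+) f i.+1) = f 0 (+) f n.
Proof.
elim: n => [|n IH]; first by rewrite big_geq // addbb.
by rewrite big_nat_recr //= IH addbA addbK.
Qed.

(** The map [Q t - P s] avoids the origin, so crossings along the boundary of the square cancel. Two
    sides count crossings of [Q] with rays from the ends of [P]; the other two, up to an antipode
    that yields the terms in [right_side], those of [P] with rays from the ends of [Q]. *)
Lemma crossings_parity n P Q :
  (forall s t : R, s \in `[0, 1] -> t \in `[0, 1] -> P s <> Q t) ->
  (forall s t : R, s \in `[0, 1] -> t \in `[0, 1] ->
    tame [set z | exists s' t' : R, [/\ s' \in `[0, 1], t' \in `[0, 1],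
      `|s' - s| <= n.+1%:R^-1, `|t' - t| <= n.+1%:R^-1 & z = Q t' - P s']]) ->
  crossings n (P 0) Q (+) crossings n (P 1) Q (+) crossings n (Q 0) P (+) crossings n (Q 1) P =
  right_side (P 0 - Q 0) (+) right_side (P 1 - Q 0) (+)
  right_side (P 0 - Q 1) (+) right_side (P 1 - Q 1).
Proof.
move=> PQ cell; pose N := n.+1; pose pt i : R := i%:R / N%:R.
have N0 : 0 < N%:R :> R by rewrite ltr0n.
have pt01 i : (i <= N)%N -> pt i \in `[0, 1].
  by move=> iN; rewrite in_itv /= /pt divr_ge0 // ler_pdivrMr // mul1r ler_nat.
have pt_dist i : `|pt i.+1 - pt i| <= N%:R^-1.
  by rewrite /pt -mulrBl -natr1 addrAC subrr add0r mul1r ger0_norm // invr_ge0 ltW.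
have pt0 : pt 0%N = 0 by rewrite /pt mul0r.
have ptN : pt N = 1 by rewrite /pt divff // gt_eqF.
pose F i j := Q (pt j) - P (pt i).
have F0 i j : (i <= N)%N -> (j <= N)%N -> F i j != 0.
  by move=> iN jN; rewrite subr_eq0; apply/eqP => /esym; apply: PQ; apply: pt01.
pose A i j := [set z | exists s' t' : R, [/\ s' \in `[0, 1], t' \in `[0, 1],
      `|s' - pt i| <= N%:R^-1, `|t' - pt j| <= N%:R^-1 & z = Q t' - P s']].
have AF i j k l : (i < N)%N -> (j < N)%N -> (k <= 1)%N -> (l <= 1)%N -> A i j (F (i + k) (j + l))%N.
  have self m : `|pt m - pt m| <= N%:R^-1 by rewrite subrr normr0 invr_ge0 ltW.
  have near m e : (e <= 1)%N -> `|pt (m + e)%N - pt m| <= N%:R^-1.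
    by case: e => [|[|]] // _; rewrite ?addn0 ?addn1; [exact: self | exact: pt_dist].
  move=> iN jN k1 l1; exists (pt (i + k)%N), (pt (j + l)%N); split=> //; try exact: near;
    apply: pt01; [apply: leq_trans iN | apply: leq_trans jN]; by rewrite -addn1 leq_add2l.
have tA i j : (i < N)%N -> (j < N)%N -> tame (A i j).
  by move=> iN jN; apply: cell; apply: pt01; apply: ltnW.
pose H i j := crosses (F i j) (F i.+1 j); pose W i j := crosses (F i j) (F i j.+1).
have HW i j : (i < N)%N -> (j < N)%N -> H i j (+) H i j.+1 = W i j (+) W i.+1 j.
  move=> iN jN; apply: (tame_cycle (tA _ _ iN jN)).
  - by have := AF i j 0%N 0%N iN jN isT isT; rewrite !addn0.
  - by have := AF i j 1%N 0%N iN jN isT isT; rewrite addn0 addn1.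
  - by have := AF i j 0%N 1%N iN jN isT isT; rewrite addn0 addn1.
  - by have := AF i j 1%N 1%N iN jN isT isT; rewrite !addn1.
(* Summing [HW] over the grid telescopes in both directions. *)
have row : \big[addb/false]_(0 <= i < N) (H i 0 (+) H i N)%N =
    \big[addb/false]_(0 <= j < N) W 0%N j (+) \big[addb/false]_(0 <= j < N) W N j.
  rewrite -(addb_telescope (fun i => \big[addb/false]_(0 <= j < N) W i j)).
  rewrite big_nat [RHS]big_nat; apply: eq_bigr => i iN.
  rewrite -(addb_telescope (H i)) -big_split.
  by rewrite big_nat [RHS]big_nat; apply: eq_bigr => j jN; apply: HW; [case/andP: iN | case/andP: jN].
(* Here [crossings] uses [P - Q], the opposite of [F]; the corrections of [tame_crossesN] telescope
   along the side. *)
have top j : (j = 0%N \/ j = N) -> crossings n (Q (pt j)) P =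
    \big[addb/false]_(0 <= i < N) H i j (+)
    (right_side (P 0 - Q (pt j)) (+) right_side (P 1 - Q (pt j))).
  move=> j0N; have jN : (j <= N)%N by case: j0N => ->.
  have e1 : right_side (P 0 - Q (pt j)) (+) right_side (P 1 - Q (pt j)) =
      right_side (F 0%N j) (+) right_side (F N j).
    by rewrite -pt0 -ptN -![P _ - _]opprB !right_sideN ?F0 // addbN addNb negbK.
  rewrite e1 -(addb_telescope (fun i => right_side (F i j))) -big_split.
  rewrite /crossings big_nat [RHS]big_nat; apply: eq_bigr => i /andP[_ iN].
  (* Cells are indexed below [N], so the side [j = N] borders the cells [A i n]. *)
  have [B [tB Bi BiS]] : exists B, [/\ tame B, B (F i j) & B (F i.+1 j)].
    case: j0N => ->; [exists (A i 0%N) | exists (A i n)]; split; try exact: tA;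
    by [have := AF i 0%N 0%N 0%N iN isT isT isT; rewrite !addn0
      | have := AF i 0%N 1%N 0%N iN isT isT isT; rewrite !addn0 addn1
      | have := AF i n 0%N 1%N iN (ltnSn n) isT isT; rewrite addn0 addn1
      | have := AF i n 1%N 1%N iN (ltnSn n) isT isT; rewrite !addn1].
  rewrite /= addbA -(tame_crossesN tB Bi BiS) ?F0 //; last exact: ltnW.
  by rewrite !opprB.
rewrite -{1}pt0 -{1}ptN; have := top _ (or_introl erefl); have := top _ (or_intror erefl).
rewrite pt0 ptN => -> ->.
have -> : crossings n (P 0) Q = \big[addb/false]_(0 <= j < N) W 0%N j.
  by rewrite -[in LHS]pt0.
have -> : crossings n (P 1) Q = \big[addb/false]_(0 <= j < N) W N j.
  by rewrite -[in LHS]ptN.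
rewrite -row big_split /=.
move: (\big[_/_]_(0 <= i < _) H _ _) (\big[_/_]_(0 <= i < _) H _ _) => p q.
by do 4 case: (right_side _); case: p; case: q.
Qed.

End Crossings.

(** * From a plane drawing to a parity system *)

Section PlanarParity.
Variables (R : realType) (V : finType) (G : sgraph V).
Hypothesis sG : simple_graph G.

Lemma itv01_cases (t : R) : t \in `[0, 1] -> [\/ t = 0, t = 1 | t \in `]0, 1[].
Proof.
rewrite !in_itv /= => /andP[]; rewrite le_eqVlt => /orP[/eqP<-|t0]; first by constructor 1.
rewrite le_eqVlt => /orP[/eqP->|t1]; first by constructor 2.
by constructor 3; rewrite t0.
Qed.

(** The clauses of a drawing concern open arcs; disjoint edges also have distinct ends, so their
    closed arcs are disjoint. *)
Lemma drawing_disjoint p (g : {set V} -> R -> R * R) e e' (s t : R) :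
  plane_drawing G p g -> e \in edges G -> e' \in edges G -> [disjoint e & e']%B ->
  s \in `[0, 1] -> t \in `[0, 1] -> g e s <> g e' t.
Proof.
move=> [inj arc vert inter] eG e'G dis s01 t01.
have [_ _ [a [b [Ee g0 g1]]]] := arc _ eG.
have [_ _ [c [d [Ee' g'0 g'1]]]] := arc _ e'G.
have [[_ /fintype.subsetP eV] [_ /fintype.subsetP e'V]] := (sG eG, sG e'G).
have ee' : e != e'.
  apply/eqP => E; have ae : a \in e by rewrite Ee !inE eqxx.
  by have := disjointFr dis ae; rewrite -E ae.
have ends r : r \in `[0, 1] -> [\/ exists2 x, x \in e & g e r = p x | r \in `]0, 1[].
  case/itv01_cases => [->|->|?]; [left; exists a|left; exists b|by right];
  by rewrite // Ee !inE eqxx ?orbT.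
have ends' r : r \in `[0, 1] -> [\/ exists2 x, x \in e' & g e' r = p x | r \in `]0, 1[].
  case/itv01_cases => [->|->|?]; [left; exists c|left; exists d|by right];
  by rewrite // Ee' !inE eqxx ?orbT.
case: (ends _ s01) => [[x xe ->]|s01']; case: (ends' _ t01) => [[y ye ->]|t01'].
- move=> /inj E; have xy := E (eV _ xe) (e'V _ ye).
  by have := disjointFr dis xe; rewrite xy ye.
- by move=> /esym; apply: vert => //; apply: eV.
- by apply: vert => //; apply: e'V.
- exact: inter.
Qed.

Lemma planar_parity : planar R G -> has_parity G.
Proof.
move=> [p [g D]]; have [inj arc _ _] := D.
pose fine n (ee : {set V} * {set V}) := ee.1 \in edges G -> ee.2 \in edges G ->
  [disjoint ee.1 & ee.2]%B -> forall s t : R, s \in `[0, 1] -> t \in `[0, 1] ->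
    tame [set z | exists s' t' : R, [/\ s' \in `[0, 1], t' \in `[0, 1],
      `|s' - s| <= n.+1%:R^-1, `|t' - t| <= n.+1%:R^-1 & z = g ee.2 t' - g ee.1 s']].
(* There are finitely many pairs of edges, so one mesh is fine enough for all. *)
have : \forall n \near \oo, forall ee, fine n ee.
  apply: (@filter_forall nat _ (fun ee n => fine n ee)) => -[e e']; rewrite /fine /=.
  have [eG|] := boolP (e \in edges G); last by move=> _; near=> n.
  have [e'G|] := boolP (e' \in edges G); last by move=> _; near=> n.
  have [dis|] := boolP [disjoint e & e']%B; last by move=> _; near=> n.
  have [ce _ _] := arc _ eG; have [ce' _ _] := arc _ e'G.
  have := tame_cells ce ce' (fun s t => drawing_disjoint D eG e'G dis).
  by move=> FH; apply: filterS FH => n Hn _ _ _; exact: Hn.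
move=> /filter_ex[n H]; pose h a c := right_side (p a - p c).
exists (fun a e => crossings n (p a) (g e)), h; split.
  move=> a b aG bG ab; rewrite /h -opprB right_sideN // subr_eq0.
  by apply: contra ab => /eqP /(inj _ _ aG bG) ->.
move=> a b c d U ab cd.
have dis : [disjoint [set a; b]%SET & [set c; d]%SET]%B.
  rewrite finset.disjoints_subset; apply/fintype.subsetP => x; rewrite !inE.
  move: U; rewrite /= !inE !negb_or => /and4P[/and3P[_ ac ad] /andP[bc bd] _ _].
  by case/orP => /eqP->; rewrite ?ac ?ad ?bc ?bd.
have [_ _ [a' [b' [/eqP Ee g0 g1]]]] := arc _ ab.
have [_ _ [c' [d' [/eqP Ee' g'0 g'1]]]] := arc _ cd.
have := crossings_parity (fun s t => drawing_disjoint D ab cd dis) (H (_, _) ab cd dis).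
rewrite g0 g1 g'0 g'1 /= -!/(h _ _).
move: Ee Ee'; rewrite !set2_eqE.
(* An arc may run in either direction; the relation is symmetric in its ends. *)
case/orP => /andP[/eqP<- /eqP<-]; case/orP => /andP[/eqP<- /eqP<-] //.
- move: (crossings _ _ _) (crossings _ _ _) (crossings _ _ _) (crossings _ _ _).
  by move: (h _ _) (h _ _) (h _ _) (h _ _); do 8 case.
- move: (crossings _ _ _) (crossings _ _ _) (crossings _ _ _) (crossings _ _ _).
  by move: (h _ _) (h _ _) (h _ _) (h _ _); do 8 case.
- move: (crossings _ _ _) (crossings _ _ _) (crossings _ _ _) (crossings _ _ _).
  by move: (h _ _) (h _ _) (h _ _) (h _ _); do 8 case.
Unshelve. all: by end_near.
Qed.

End PlanarParity.

Local Close Scope classical_set_scope.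

(** * Straight-line drawings *)

Section Plane.
Variable R : realFieldType.
Implicit Types (a b c p q x y z : R * R) (r s t : R).

Definition seg a b t : R * R := (a.1 + t * (b.1 - a.1), a.2 + t * (b.2 - a.2)).

(** Twice the signed area of the triangle. *)
Definition det a b c : R :=
  (b.1 - a.1) * (c.2 - a.2) - (b.2 - a.2) * (c.1 - a.1).

(* The open triangle with vertices [a], [b], [c]; empty when they are collinear. *)
Definition tri a b c z : Prop :=
  [/\ 0 < det a b c * det a b z, 0 < det a b c * det b c z & 0 < det a b c * det c a z].

Lemma seg0 a b : seg a b 0 = a.
Proof. by case: a b => [? ?] [? ?]; rewrite /seg !mul0r !addr0. Qed.

Lemma seg1 a b : seg a b 1 = b.
Proof. by case: a b => [? ?] [? ?]; rewrite /seg !mul1r !subrKC. Qed.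

Lemma seg_sym a b t : seg a b t = seg b a (1 - t).
Proof. by case: a b => [? ?] [? ?]; congr pair; rewrite /=; ring. Qed.

Lemma seg_inj a b s t : a != b -> seg a b s = seg a b t -> s = t.
Proof.
case: a b => [a1 a2] [b1 b2]; rewrite xpair_eqE negb_and => ab [/addrI E1 /addrI E2].
have key (u v : R) : u != v -> s * (v - u) = t * (v - u) -> s = t.
  by move=> uv; apply: mulIf; rewrite subr_eq0 eq_sym.
by case/orP: ab => /key; [apply | apply].
Qed.

Lemma det_cyc a b c : det a b c = det b c a.
Proof. rewrite /det; ring. Qed.

Lemma det_swap a b c : det b a c = - det a b c.
Proof. rewrite /det; ring. Qed.

Lemma det_seg a b p q t : det a b (seg p q t) = (1 - t) * det a b p + t * det a b q.
Proof. rewrite /det /seg /=; ring. Qed.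

Lemma detxx a b : (det a b a = 0) * (det a b b = 0).
Proof. by split; rewrite /det; ring. Qed.

Lemma tri_swap a b c z : tri a b c z -> tri b a c z.
Proof.
rewrite /tri (det_swap a b c) (det_swap a b z) (det_swap c a z) (det_swap b c z).
by rewrite !mulrNN => -[].
Qed.

Lemma tri_cevian a b c s r : det a b c != 0 -> 0 < s < 1 -> 0 < r < 1 ->
  tri a b c (seg (seg a b s) c r).
Proof.
move=> D0 /andP[s0 s1] /andP[r0 r1].
have [s1' r1'] : 0 < 1 - s /\ 0 < 1 - r by rewrite !subr_gt0.
have sq : 0 < det a b c * det a b c by rewrite -expr2 exprn_even_gt0.
split.
- have -> : det a b (seg (seg a b s) c r) = r * det a b c by rewrite /det /seg /=; ring.
  by rewrite mulrCA mulr_gt0.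
- have -> : det b c (seg (seg a b s) c r) = (1 - r) * (1 - s) * det a b c.
    by rewrite /det /seg /=; ring.
  by rewrite mulrCA mulr_gt0 // mulr_gt0.
- have -> : det c a (seg (seg a b s) c r) = (1 - r) * s * det a b c.
    by rewrite /det /seg /=; ring.
  by rewrite mulrCA mulr_gt0 // mulr_gt0.
Qed.

Lemma tri_seg a b c p t : tri a b c p -> 0 <= t < 1 -> tri a b c (seg p a t).
Proof.
move=> [h1 h2 h3] /andP[t0 t1]; have t1' : 0 < 1 - t by rewrite subr_gt0.
have sq : 0 < det a b c * det a b c.
  by rewrite -expr2 exprn_even_gt0 //=; apply: contraTneq h1 => ->; rewrite mul0r ltxx.
split; rewrite !det_seg mulrDr ![det a b c * (_ * _)]mulrCA.
- by rewrite detxx !mulr0 addr0 mulr_gt0.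
- rewrite -(det_cyc a); apply: ltr_wpDr; last exact: mulr_gt0.
  by rewrite mulr_ge0 // ltW.
- by rewrite detxx !mulr0 addr0 mulr_gt0.
Qed.

(** Each half cut off by a cevian inherits the emptiness of the whole triangle. *)
Lemma tri_half a b c s z : 0 < s < 1 -> tri (seg a b s) c a z -> tri a b c z.
Proof.
move=> /andP[s0 s1]; set v := seg a b s => -[h1 h2 h3].
have s1' : 0 < 1 - s by rewrite subr_gt0.
have Dv : det v c a = s * det a b c by rewrite /v /det /seg /=; ring.
have E3 : det a v z = s * det a b z by rewrite /v /det /seg /=; ring.
have E1 : det v c z = (1 - s) * det a c z + s * det b c z by rewrite /v /det /seg /=; ring.
have Eac : det a c z = - det c a z by exact: det_swap.
rewrite Dv in h1 h2 h3; rewrite E3 in h3; rewrite E1 Eac in h1.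
rewrite -mulrA pmulr_rgt0 // in h2.
have {}h3 : 0 < det a b c * det a b z.
  by move: h3; rewrite -mulrA pmulr_rgt0 // mulrCA pmulr_rgt0.
have {}h1 : 0 < det a b c * ((1 - s) * - det c a z + s * det b c z).
  by move: h1; rewrite -mulrA pmulr_rgt0.
have h2' : 0 < (1 - s) * (det a b c * det c a z) by rewrite mulr_gt0.
have h4 : 0 < s * (det a b c * det b c z) by lra.
by split=> //; move: h4; rewrite pmulr_rgt0.
Qed.

Lemma tri_sub a b c p z : tri a b c p -> tri a b p z -> tri a b c z.
Proof.
move=> [h1 h2 h3] [k1 k2 k3].
have sq : 0 < det a b c * det a b c.
  by rewrite -expr2 exprn_even_gt0 //=; apply: contraTneq h1 => ->; rewrite mul0r ltxx.
have sp : 0 < det a b p * det a b p.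
  by rewrite -expr2 exprn_even_gt0 //=; apply: contraTneq h1 => ->; rewrite mulr0 ltxx.
have m1 : 0 < det a b c * det a b z.
  have : 0 < (det a b c * det a b p) * (det a b p * det a b z) by rewrite mulr_gt0.
  have -> : (det a b c * det a b p) * (det a b p * det a b z) =
    (det a b p * det a b p) * (det a b c * det a b z) by ring.
  by rewrite pmulr_rgt0.
(* Three-term Plücker relations; multiplied by [det a b p] and [det a b c], they yield sums of
   positive terms. *)
have E2 : det a b p * det b c z = det b p z * det a b c + det a b z * det b c p.
  by rewrite /det; ring.
have E3 : det a b p * det c a z = det p a z * det a b c + det a b z * det c a p.
  by rewrite /det; ring.
have expand (q r s t : R) : det a b p * q = r * det a b c + s * t ->
    (det a b p * det a b p) * (det a b c * q) =
    (det a b p * r) * (det a b c * det a b c) + (det a b p * s) * (det a b c * t).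
  move=> E; have -> : (det a b p * det a b p) * (det a b c * q) =
    det a b p * det a b c * (det a b p * q) by ring.
  by rewrite E; ring.
split; first exact: m1.
- by rewrite -(pmulr_rgt0 _ sp) (expand _ _ _ _ E2) addr_gt0 // mulr_gt0.
- by rewrite -(pmulr_rgt0 _ sp) (expand _ _ _ _ E3) addr_gt0 // mulr_gt0.
Qed.

Lemma seg_fork p a b s t : det p a b != 0 -> t != 0 -> seg p a s <> seg p b t.
Proof.
move=> D t0 E; have : det p a (seg p b t) = 0 by rewrite -E det_seg !detxx !mulr0 addr0.
by rewrite det_seg detxx mulr0 add0r => /eqP; rewrite mulf_eq0 (negPf D) (negPf t0).
Qed.

Lemma seg_half_l a b t : seg (seg a b 2^-1) a t = seg a b ((1 - t) / 2).
Proof. by case: a b => [? ?] [? ?]; rewrite /seg /=; congr pair; field. Qed.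

Lemma seg_half_r a b t : seg (seg a b 2^-1) b t = seg a b ((1 + t) / 2).
Proof. by case: a b => [? ?] [? ?]; rewrite /seg /=; congr pair; field. Qed.

Lemma half01 : 0 < (2^-1 : R) < 1.
Proof. by apply/andP; split; lra. Qed.

Lemma seg_split p q s t : p != q -> 0 < s -> 0 < t ->
  let m := seg p q 2^-1 in seg m p s <> seg m q t.
Proof.
move=> pq s0 t0 /= E.
by move: E; rewrite seg_half_l seg_half_r => /(seg_inj pq); lra.
Qed.

End Plane.

(** * Extending a straight-line drawing inside empty triangles *)

Section Straight.
Variables (R : realFieldType) (V : finType).
Implicit Types (G H : sgraph V) (f : V -> R * R) (T : R * R -> Prop).
Implicit Types (u v w z : V) (Z : R * R).

Definition edge_point G f (e : {set V}) (x : R * R) : Prop :=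
  exists a b t, [/\ e = [set a; b]%SET, adj G a b, 0 < t < 1 & x = seg (f a) (f b) t].

Definition straight G f : Prop :=
  [/\ {in verts G &, injective f},
      forall e x c, edge_point G f e x -> c \in verts G -> x <> f c
    & forall e e' x, edge_point G f e x -> edge_point G f e' x -> e = e'].

Definition avoids G f T : Prop :=
  (forall c, c \in verts G -> ~ T (f c)) /\ forall e x, edge_point G f e x -> ~ T x.

Definition vacant G f (a b c : R * R) : Prop :=
  det a b c != 0 /\ avoids G f (tri a b c).

Definition upd f z Z : V -> R * R := fun a => if a == z then Z else f a.

Lemma upd_new f z Z : upd f z Z z = Z.
Proof. by rewrite /upd eqxx. Qed.

Lemma upd_old G f z Z c : z \notin verts G -> c \in verts G -> upd f z Z c = f c.
Proof. by move=> zG cG; rewrite /upd; case: eqVneq => // E; rewrite -E cG in zG. Qed.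

Lemma edge_point_ext G f z Z u w e x : simple_graph G -> z \notin verts G ->
  u \in verts G -> w \in verts G -> edge_point (ext G z u w) (upd f z Z) e x ->
  edge_point G f e x \/ exists2 a, (a == u) || (a == w) &
    exists2 t, 0 < t < 1 & e = [set z; a]%SET /\ x = seg Z (f a) t.
Proof.
move=> sG zG uG wG [a [b [t [Ee ab t01 ->]]]].
have old c : (c == u) || (c == w) -> upd f z Z c = f c.
  by move=> cu; apply: (upd_old (G := G)) => //; case/orP: cu => /eqP->.
move: ab; rewrite adj_ext; case/or3P => [ab|/andP[/eqP az bu]|/andP[/eqP bz au]].
- have [_ aG bG] := simple_adj sG ab.
  by left; exists a, b, t; split; rewrite // !(upd_old (G := G)).
- by right; exists b => //; exists t => //; rewrite Ee az upd_new old.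
- right; exists a => //; exists (1 - t).
    by case/andP: t01 => t0 t1; apply/andP; split; lra.
  by rewrite Ee bz upd_new old // [seg (f a) _ _]seg_sym; split=> //; rewrite finset.setUC.
Qed.

Section Extension.
Variables (G : sgraph V) (f : V -> R * R) (z u w : V) (Z : R * R) (T : R * R -> Prop).
Hypotheses (sG : simple_graph G) (zG : z \notin verts G).
Hypotheses (uG : u \in verts G) (wG : w \in verts G).
Hypothesis avT : avoids G f T.

(** The region [T] meets nothing drawn so far and contains the new vertex with its two open edges,
    so only these two edges could meet. *)
Lemma straight_ext : straight G f -> T Z ->
  (forall a t, (a == u) || (a == w) -> 0 < t < 1 -> T (seg Z (f a) t)) ->
  (forall s t, 0 < s < 1 -> 0 < t < 1 -> seg Z (f u) s <> seg Z (f w) t) ->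
  straight (ext G z u w) (upd f z Z).
Proof.
move=> [inj vert inter] TZ Tseg fork; case: avT => avV avE.
have neZ a : a \in verts G -> f a <> Z by move=> /avV + E; rewrite E.
have uwG a : (a == u) || (a == w) -> a \in verts G by case/orP => /eqP->.
have old c : c \in verts G -> upd f z Z c = f c by apply: upd_old.
split.
- move=> a b; rewrite /= !in_setU1 => /orP[/eqP->|aG] /orP[/eqP->|bG] //;
    rewrite ?upd_new ?old //.
  + by move=> /esym /neZ-/(_ bG).
  + by move=> /neZ-/(_ aG).
  + exact: inj.
- move=> e x c /(edge_point_ext sG zG uG wG) ex; rewrite /= in_setU1.
  case/orP => [/eqP->|cG]; rewrite ?upd_new ?old //.
    case: ex => [/avE nT xZ|[a auw [t t01 [_ ->]]]]; first by rewrite xZ in nT.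
    rewrite -[in RHS](seg0 Z (f a)) => /seg_inj E.
    have Za : Z != f a by apply/eqP => /esym /neZ; apply; apply: uwG.
    by move: t01; rewrite (E Za) ltxx.
  case: ex => [|[a auw [t t01 [_ ->]]]]; first by move/vert; apply.
  by move=> E; apply: (avV _ cG); rewrite -E; apply: Tseg.
- move=> e e' x /(edge_point_ext sG zG uG wG) ex /(edge_point_ext sG zG uG wG) ex'.
  case: ex ex' => [ex|[a auw [t t01 [-> xE]]]]; case=> [ex'|[b buw [s s01 [-> xE']]]].
  + exact: inter ex ex'.
  + by case: (avE _ _ ex); rewrite xE'; apply: Tseg.
  + by case: (avE _ _ ex'); rewrite xE; apply: Tseg.
  + rewrite xE in xE'; case/orP: auw buw xE' => /eqP-> /orP[]/eqP-> // /esym.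
      by move=> /esym /fork; case.
    by move=> /fork; case.
Qed.

Lemma avoids_ext T' : (forall x, T' x -> T x) -> ~ T' Z ->
  (forall a t, (a == u) || (a == w) -> 0 < t < 1 -> ~ T' (seg Z (f a) t)) ->
  avoids (ext G z u w) (upd f z Z) T'.
Proof.
case: avT => avV avE sub nZ nseg; split.
  move=> c; rewrite /= in_setU1 => /orP[/eqP->|cG]; first by rewrite upd_new.
  by rewrite (upd_old (G := G)) // => /sub; apply: avV.
move=> e x /(edge_point_ext sG zG uG wG)[/avE + /sub //|[a auw [t t01 [_ ->]]]].
exact: nseg.
Qed.

End Extension.

(** [z] is the midpoint of the cevian from [v] to [c], whose halves are its edges. The cevian splits
    the empty triangle [u w c] and leaves an empty triangle on each side. *)
Lemma cevian_step G f z u w v c s : simple_graph G -> z \notin verts G ->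
  u \in verts G -> w \in verts G -> v \in verts G -> c \in verts G -> v != c ->
  0 < s < 1 -> f v = seg (f u) (f w) s -> vacant G f (f u) (f w) (f c) -> straight G f ->
  let f' := upd f z (seg (f v) (f c) 2^-1) in let G' := ext G z v c in
  [/\ straight G' f', vacant G' f' (f' v) (f' c) (f' u) & vacant G' f' (f' v) (f' c) (f' w)].
Proof.
move=> sG zG uG wG vG cG vc s01 fv [D0 av] str /=.
have onT r : 0 < r < 1 -> tri (f u) (f w) (f c) (seg (f v) (f c) r).
  by move=> r01; rewrite fv; apply: tri_cevian.
have onL a t : (a == v) || (a == c) -> 0 < t < 1 -> exists2 r, 0 < r < 1 &
    seg (seg (f v) (f c) 2^-1) (f a) t = seg (f v) (f c) r.
  move=> avc /andP[t0 t1]; case/orP: avc => /eqP->.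
    by exists ((1 - t) / 2); [apply/andP; split; lra | exact: seg_half_l].
  by exists ((1 + t) / 2); [apply/andP; split; lra | exact: seg_half_r].
have fvc : f v != f c.
  have [inj _ _] := str; by apply: contra vc => /eqP /(inj _ _ vG cG) ->.
have nline q r : ~ tri (f v) (f c) q (seg (f v) (f c) r).
  by case; rewrite det_seg !detxx !mulr0 addr0 mulr0 ltxx.
have vac q : det (f v) (f c) q != 0 ->
    (forall x, tri (f v) (f c) q x -> tri (f u) (f w) (f c) x) ->
    vacant (ext G z v c) (upd f z (seg (f v) (f c) 2^-1)) (f v) (f c) q.
  move=> q0 sub; split=> //; apply: (avoids_ext sG zG vG cG av) => // a t /onL h /h[r _ ->].
  exact: nline.
rewrite !(upd_old (G := G)) //; have /andP[s0 s1] := s01; split.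
- apply: (straight_ext sG zG vG cG av str); first exact: onT (half01 R).
    by move=> a t /onL h /h[r r01 ->]; apply: onT.
  by move=> r t /andP[r0 _] /andP[t0 _]; apply: seg_split.
- apply: vac.
    have -> : det (f v) (f c) (f u) = s * det (f u) (f w) (f c).
      by rewrite fv /det /seg /=; ring.
    by rewrite mulf_neq0 // gt_eqF.
  by move=> x; rewrite fv; apply: tri_half.
- apply: vac.
    have -> : det (f v) (f c) (f w) = - ((1 - s) * det (f u) (f w) (f c)).
      by rewrite fv /det /seg /=; ring.
    by rewrite oppr_eq0 mulf_neq0 // gt_eqF // subr_gt0.
  move=> x; rewrite fv seg_sym => /tri_half h; apply/tri_swap/h.
  by apply/andP; split; lra.
Qed.

(* The last vertex [v] lies on the open segment between its neighbors [u] and [w], and the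
   triangles over that segment into which later steps draw are empty. *)
Definition drawn G v u w : Prop := exists f,
  [/\ straight G f, exists2 s, 0 < s < 1 & f v = seg (f u) (f w) s,
      forall c, c != v -> adj G u c -> adj G w c -> vacant G f (f u) (f w) (f c)
    & exists y, vacant G f (f u) (f w) y].

(** Besides [z], only [u] and [w] are neighbors of [v], so they are the only other candidates for
    common neighbors of [v] and [c], and both triangles are empty. *)
Lemma drawn_cevian G f z u w v c s : simple_graph G -> z \notin verts G ->
  u \in verts G -> w \in verts G -> v \in verts G -> c \in verts G -> v != c ->
  (forall d, adj G v d = (d == u) || (d == w)) ->
  0 < s < 1 -> f v = seg (f u) (f w) s -> vacant G f (f u) (f w) (f c) -> straight G f ->
  drawn (ext G z v c) z v c.
Proof.
move=> sG zG uG wG vG cG vc N s01 fv vac str.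
have [str' vu vw] := cevian_step sG zG uG wG vG cG vc s01 fv vac str.
have vz : v != z by apply: contraNneq zG => <-.
exists (upd f z (seg (f v) (f c) 2^-1)); split=> //.
- by exists 2^-1; rewrite ?half01 // upd_new !(upd_old (G := G)).
- move=> d dz; rewrite adj_ext_old // N => /orP[]/eqP-> _ //.
- by exists (upd f z (seg (f v) (f c) 2^-1) u).
Qed.

Lemma gated_drawn G v u w : gated G v u w -> drawn G v u w.
Proof.
elim=> {G v u w} [x y v xy vx vy|G v u w c z gG [f [str [s s01 fv] com [Y vacY]]] cv uc wc zG|
  G v u w t z gG [f [str [s s01 fv] com [Y vacY]]] tG zG].
(* [x], [v], [y] lie in this order on the horizontal axis; an apex off the axis gives an empty
   triangle. *)
- pose f a : R * R := if a == x then (0, 0) else (1, 0).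
  have fx : f x = (0, 0) by rewrite /f eqxx.
  have fy : f y = (1, 0) by rewrite /f eq_sym (negPf xy).
  have noe e p : ~ edge_point (pairg x y) f e p by case=> a [b [t [_ ]]]; rewrite adj_pairg.
  have xP : x \in verts (pairg x y) by rewrite !inE eqxx.
  have yP : y \in verts (pairg x y) by rewrite !inE eqxx orbT.
  have vP : v \notin verts (pairg x y) by rewrite !inE negb_or vx.
  have sP := @simple_pairg _ x y.
  have str : straight (pairg x y) f.
    split=> [a b|e p c /noe //|e e' p /noe //].
    rewrite !inE => /orP[]/eqP-> /orP[]/eqP->; rewrite // fx fy => -[] /eqP.
      by rewrite eq_sym oner_eq0.
    by rewrite oner_eq0.
  pose T p := exists2 r : R, 0 < r < 1 & p = seg (f x) (f y) r.
  have fxy : f x != f y by rewrite fx fy xpair_eqE eq_sym oner_eq0.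
  have avT : avoids (pairg x y) f T.
    split=> [c|e p /noe //]; rewrite !inE => /orP[]/eqP-> [r r01].
      by rewrite -[LHS](seg0 (f x) (f y)) => /(seg_inj fxy) E; rewrite -E ltxx in r01.
    by rewrite -[LHS](seg1 (f x) (f y)) => /(seg_inj fxy) E; rewrite -E ltxx andbF in r01.
  pose g := upd f v (seg (f x) (f y) 2^-1).
  have onL a t : (a == x) || (a == y) -> 0 < t < 1 -> T (seg (seg (f x) (f y) 2^-1) (f a) t).
    move=> /orP[]/eqP-> /andP[t0 t1].
      by exists ((1 - t) / 2); [apply/andP; split; lra | exact: seg_half_l].
    by exists ((1 + t) / 2); [apply/andP; split; lra | exact: seg_half_r].
  exists g; split.
  + apply: (straight_ext sP vP xP yP avT str) => //; first by exists 2^-1; rewrite ?half01.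
    by move=> r t /andP[r0 _] /andP[t0 _]; apply: seg_split.
  + by exists 2^-1; rewrite ?half01 // /g upd_new !(upd_old (G := pairg x y)).
  + move=> c cv; have xv : x != v by rewrite eq_sym.
    by rewrite adj_ext_old // adj_pairg.
  + exists (0, 1); rewrite /g !(upd_old (G := pairg x y)) // fx fy.
    split; first by rewrite /det /= !(subr0, mulr1, mulr0) oner_eq0.
    have avF : avoids (pairg x y) f (fun p => p.2 = 0 -> False).
      split=> [c|e p /noe //]; rewrite !inE => /orP[]/eqP->; rewrite ?fx ?fy /=; by apply.
    apply: (avoids_ext sP vP xP yP avF).
    * move=> [p1 p2] [+ _ _] /= p0; rewrite p0 /det /= ; clear; lra.
    * by case=> + _ _; rewrite /det /seg /= ; clear; lra.
    * by move=> a t /orP[]/eqP-> _ [+ _ _]; rewrite ?fx ?fy /det /seg /= ; clear; lra.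
- have [sG uw vG N] := gated_facts gG.
  have [_ uG cG] := simple_adj sG uc; have [_ wG _] := simple_adj sG wc.
  by apply: (drawn_cevian sG zG uG wG vG cG _ N s01 fv (com c cv uc wc) str); rewrite eq_sym.
- have [sG uw vG N] := gated_facts gG.
  have [vu _ uG] : [/\ v != u, v \in verts G & u \in verts G] by apply: simple_adj; rewrite // N eqxx.
  have [vw _ wG] : [/\ v != w, v \in verts G & w \in verts G] by apply: simple_adj; rewrite // N eqxx orbT.
  have [D0 av] := vacY.
  (* The twin [t] goes halfway from [v] to the apex of a spare empty triangle; [z] is then drawn on
     the cevian of the smaller triangle [u w t]. *)
  pose P := seg (f v) Y 2^-1; pose g := upd f t P.
  have TP : tri (f u) (f w) Y P by rewrite /P fv; apply: tri_cevian; rewrite ?half01.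
  have DP : det (f u) (f w) P != 0.
    by case: TP => + _ _; apply: contraTneq => ->; rewrite mulr0 ltxx.
  have str' : straight (ext G t u w) g.
    apply: (straight_ext sG tG uG wG av str TP).
      move=> a r auw /andP[r0 r1]; case/orP: auw => /eqP->.
        by apply: tri_seg => //; rewrite ltW.
      apply: tri_swap; apply: tri_seg; last by rewrite ltW.
      exact: tri_swap.
    move=> r r' _ /andP[r0 _]; apply: seg_fork; last by rewrite gt_eqF.
    by rewrite det_cyc.
  have old c : c \in verts G -> g c = f c by apply: upd_old.
  have vac' : vacant (ext G t u w) g (g u) (g w) (g t).
    rewrite [g t]upd_new !old //; split=> //.
    apply: (avoids_ext sG tG uG wG av) => [p|[_ + _]|a r /orP[]/eqP-> _ [_ h2 h3]].
    + exact: tri_sub.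
    + by rewrite detxx mulr0 ltxx.
    + by move: h3; rewrite det_seg !detxx !mulr0 addr0 mulr0 ltxx.
    + move: h2; rewrite -[det _ _ (seg _ _ _)]opprK -det_swap det_seg !detxx.
      by rewrite !mulr0 addr0 oppr0 mulr0 ltxx.
  have tu : t \in verts (ext G t u w) by rewrite !inE eqxx.
  have up c : c \in verts G -> c \in verts (ext G t u w) by rewrite !inE => ->; rewrite orbT.
  have vt : v != t by apply: contraNneq tG => <-.
  apply: (drawn_cevian _ zG (up _ uG) (up _ wG) (up _ vG) tu vt _ s01 _ vac' str').
  + exact: simple_ext.
  + move=> d; have [->|dt] := eqVneq d t; last by rewrite adj_ext_old.
    rewrite adjC adj_ext_new // (negPf vu) (negPf vw).
    by apply/esym/negbTE; rewrite negb_or; apply/andP; split; apply: contraNneq tG => ->.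
  + by rewrite !old.
Qed.

End Straight.

(** * Straight-line drawings as drawings by arcs *)

Lemma continuous_seg (R : realType) (a b : R * R) : continuous (seg a b).
Proof.
move=> t; have affine (c d : R) : ((fun r => c + r * d) @ t --> c + t * d)%classic.
  by apply: cvgD; [exact: cvg_cst | apply: cvgM; [exact: cvg_id | exact: cvg_cst]].
exact: cvg_pair (affine _ _) (affine _ _).
Qed.

Lemma straight_planar (R : realType) (V : finType) (G : sgraph V) (f : V -> R * R) :
  simple_graph G -> straight G f -> planar R G.
Proof.
move=> sG [inj vert inter].
(* [pick] chooses a direction for each edge; the constant map is a default for other sets. *)
pose g (e : {set V}) : R -> R * R :=
  if [pick ab : V * V | e == [set ab.1; ab.2]%SET] is Some ab
  then seg (f ab.1) (f ab.2) else fun _ => 0.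
have gE e : e \in edges G -> exists a b, [/\ e = [set a; b]%SET, adj G a b & g e = seg (f a) (f b)].
  move=> eG; rewrite /g; case: pickP => [[a b] /= /eqP E|none].
    by exists a, b; rewrite /adj -E.
  have [/eqP/cards2P[a [b [_ E]]] _] := sG e eG.
  by have := none (a, b); rewrite /= E eqxx.
have ep e (t : R) : e \in edges G -> t \in `]0, 1[ -> edge_point G f e (g e t).
  move=> eG; rewrite in_itv /= => t01; have [a [b [Ee ab ->]]] := gE _ eG.
  by exists a, b, t.
exists f, g; split=> //.
- move=> e eG; have [a [b [Ee ab ->]]] := gE _ eG.
  have [nab aG bG] := simple_adj sG ab; split.
  + by apply: continuous_subspaceT; apply: continuous_seg.
  + move=> s t _ _; apply: seg_inj.
    by apply: contra nab => /eqP /(inj _ _ aG bG) ->.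
  + by exists a, b; rewrite seg0 seg1.
- by move=> e v t eG vG t01; apply: vert (ep _ _ eG t01) vG.
- move=> e e' t t' eG e'G ee' t01 t01' E; move: ee'.
  rewrite (inter e e' (g e t)) ?eqxx //; first exact: ep.
  by rewrite E; apply: ep.
Qed.

Theorem theorem3 (R : realType) (V : finType) (G : sgraph V)
    (simpleG : simple_graph G) (one_pathG : one_path G) (noK3 : ~ has_K3 G) :
  LCC G <-> planar R G.
Proof.
have tf := no_K3_triangle_free simpleG noK3.
have [_ [x [y [s [cG one]]]]] := one_pathG.
split=> [/(LCC_stacked simpleG tf) stG|/(planar_parity simpleG) par].
  (* The construction that shows LCC need not be the 1-path one; stackedness of [G] transfers the
     property. *)
  have sts := stacked_steps_of_stacked tf cG stG.
  have s0 : (0 < size s)%N by rewrite -one; apply: count_size.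
  have [v [u [w /gated_drawn-/(_ R)[f [str _ _ _]]]]] := gated_top tf cG sts one s0.
  exact: straight_planar str.
(* Conversely, the given construction itself witnesses LCC. *)
exists x, y; apply: (stacked_steps_LCC tf cG).
exact: (parity_stacked_steps tf cG par).
Qed.
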